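(* Let $d\ge1$, $s\in(d-1,d)$, $\beta>0$, and let $\mathbb{P}^\beta_\star$, $H^\beta_{\star,\Delta}$ be as defined in the context. Let $\Delta$ be a bounded Borel subset of $\mathbb{R}^d$ and $f:\mathcal{C}\to\mathbb{R}$ a bounded measurable function. Then $$\int f(\gamma)\,\mathbb{P}^\beta_\star(d\gamma)=\iint\frac{1}{Z^\beta_{\star,\Delta}(\gamma)}\,f(\eta\cup\gamma_{\Delta^c})\,e^{-\beta H^\beta_{\star,\Delta}(\eta,\gamma)}\,\Pi_\Delta(d\eta)\,\mathbb{P}^\beta_\star(d\gamma),$$ with the finite and nonzero normalisation constant $$Z^\beta_{\star,\Delta}(\gamma)=\int e^{-\beta H^\beta_{\star,\Delta}(\eta,\gamma)}\,\Pi_\Delta(d\eta).$$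
   Context: Fix an integer $d\ge1$ and a real $s\in(d-1,d)$; $\lambda^d$ is Lebesgue measure, $g(x)=\|x\|^{-s}$ on $\mathbb{R}^d$ ($g(0)=+\infty$). $\mathcal{C}$ is the set of locally finite subsets (configurations) of $\mathbb{R}^d$, $N_\Delta(\gamma)=|\gamma\cap\Delta|$, $\gamma_\Delta=\gamma\cap\Delta$, $\Delta^c=\mathbb{R}^d\setminus\Delta$; $\mathcal{C}$ carries the $\sigma$-algebra $\mathcal{F}$ generated by all $N_\Delta$, $\Delta$ bounded Borel; $\mathcal{F}_\Lambda=\sigma(N_B:B\subset\Lambda\text{ bounded Borel})$. A point process is a probability measure on $(\mathcal{C},\mathcal{F})$. $\Lambda_n=[-n^{1/d}/2,n^{1/d}/2]^d$. $\Pi_\Delta$ is the Poisson point process of intensity 1 in $\Delta$. Finite volume: $\mathbb{B}_{\Lambda,N}$ is the law of $N$ independent uniform points in $\Lambda$; for $n\ge1$, $$g_n(x)=\sum_{k\in\mathbb{Z}^d}\Big(g(x+kn^{1/d})-\frac1n\int_{\Lambda_n}g(y+kn^{1/d})\,dy\Big),\qquad H_n(\gamma)=\sum_{\{x,y\}\subset\gamma}g_n(x-y),\qquad h_n(x,\gamma)=\sum_{y\in\gamma}g_n(x-y)$$ for $\gamma\subset\Lambda_n$, $x\in\Lambda_n$; $Z_n^\beta=\int e^{-\beta H_n}d\mathbb{B}_{\Lambda_n,n}$, $\mathbb{P}_n^\beta=\frac1{Z_n^\beta}e^{-\beta H_n}\mathbb{B}_{\Lambda_n,n}$. A function on $\mathcal{C}$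 is local if it is $\mathcal{F}_\Delta$-measurable for some bounded Borel $\Delta$, tame if $|f|\le b(1+N_\Delta)$ for some $b>0$ and bounded Borel $\Delta$; the local topology on point processes is the smallest one making $\mathbb{P}\mapsto\int f\,d\mathbb{P}$ continuous for all local tame $f$. The process $\mathbb{P}^\beta_\star$: there are $K>0$ and an increasing sequence $(n_j)_{j\ge1}$ with $E_{\mathbb{P}^\beta_{n_j}}(|h_{n_j}(0,\cdot)|)\le K$ for all $j$; fix such a sequence and let $\mathbb{P}^\beta_\star$ be an accumulation point (limit of a subsequence in the local topology) of $(\mathbb{P}^\beta_{n_j})_j$. It is stationary with intensity 1. Local energy: let $V(x,\gamma)=\lim_{p\to\infty}\sum_{y\in\gamma\cap\Lambda_p}[g(y-x)-g(y)]$, which for $\mathbb{P}^\beta_\star$-almost every $\gamma$ exists and is finite for all $x\in\mathbb{R}^d\setminus\gamma$. The one-point Campbell measure $C^{(1)}_{\mathbb{P}^\beta_\star}$ is defined by $C^{(1)}_{\mathbb{P}^\beta_\star}(f)=\int\sum_{x\in\gamma}f(x,\gamma\setminus\{x\})\,\mathbb{P}^\beta_\star(d\gamma)$ for measurable $f\ge0$ on $\mathbb{R}^d\times\mathcal{C}$. There is a measurable function $\Psi^\beta_\star:\mathcal{C}\to\mathbb{R}$, unique $\mathbb{P}^\beta_\star$-a.e., such that $$C^{(1)}_{\mathbb{P}^\beta_\star}(f)=\iint f(x,\gamma)\,e^{-\beta(V(x,\gamma)+\Psi^\beta_\star(\gamma))}\,\mathbb{P}^\beta_\star(d\gamma)\,dx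 .$$ The local energy of a point is $h^\beta_\star(x,\gamma)=V(x,\gamma)+\Psi^\beta_\star(\gamma)$. (Equivalently, $h^\beta_\star(x,\gamma)=\lim_p\big[\sum_{y\in\gamma_{\Lambda_p}}g(y-x)+C_p(N_{\Lambda_p}(\gamma),\gamma_{\Lambda_p^c})\big]$ for suitable measurable functions $C_p:\mathbb{N}\times\mathcal{C}\to\mathbb{R}$.) For $\eta=\{x_1,\dots,x_n\}\subset\Delta$, $$H^\beta_{\star,\Delta}(\eta,\gamma)=h^\beta_\star(x_1,\gamma_{\Delta^c})+h^\beta_\star(x_2,\gamma_{\Delta^c}\cup\{x_1\})+\dots+h^\beta_\star(x_n,\gamma_{\Delta^c}\cup\{x_1,\dots,x_{n-1}\}),$$ with $H^\beta_{\star,\Delta}(\emptyset,\gamma)=0$; for $\mathbb{P}^\beta_\star$-a.e. $\gamma$ and $\Pi_\Delta$-a.e. $\eta$ this is well defined and independent of the ordering of the points of $\eta$. *)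

(* Defs.v *)
From HB Require Import structures.
From mathcomp Require Import all_boot all_order all_algebra finmap.
From mathcomp Require Import all_classical all_reals all_analysis.
From mathcomp Require Import measurable_realfun.

Set Implicit Arguments.
Unset Strict Implicit.
Unset Printing Implicit Defensive.

Import Order.TTheory GRing.Theory Num.Theory.
Import numFieldNormedType.Exports.

Local Open Scope classical_set_scope.
Local Open Scope ring_scope.

(* The Borel sigma-algebra of R^d. *)
Definition rV_display : measure_display. Proof. by constructor. Qed.

Section borel_rV.
Context {R : realType} {d : nat}.

HB.instance Definition _ := @isMeasurable.Build rV_display 'rV[R]_d
  <<s (@open 'rV[R]_d) >>
  (@sigma_algebra0 _ setT _) (@sigma_algebraC _ _)
  (@sigma_algebra_bigcup _ setT _).

End borel_rV.

(* The product measure mu^n on n-tuples. *)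
Section power_measure.
Context {dT : measure_display} {T : measurableType dT} {R : realType}.
Local Open Scope ereal_scope.

Fixpoint power_measure (mu : set T -> \bar R) (n : nat) :
    set (n.-tuple T) -> \bar R :=
  match n with
  | 0 => \d_([tuple] : 0.-tuple T)
  | n'.+1 => pushforward (mu \x @power_measure mu n')
               (fun p : T * n'.-tuple T => [tuple of p.1 :: p.2])
  end.

End power_measure.
Arguments power_measure {dT T R} mu n _.

Section euclidean.
Context {R : realType} {d : nat}.
Local Notation E := 'rV[R]_d.

Definition lebesgue_rV : set E -> \bar R :=
  pushforward
    (power_measure (@lebesgue_measure R : set (measurableTypeR R) -> \bar R) d)
    (fun t : d.-tuple (measurableTypeR R) => (\row_i tnth t i : E)).

(* The norm of 'rV[R]_d in the library is the sup norm. *)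
Definition norm2 (x : E) : R := Num.sqrt (\sum_i x ord0 i ^+ 2).

Definition bounded_borel (A : set E) : Prop := measurable A /\ bounded_set A.

(* n^(1/d) *)
Definition side (n : nat) : R := n%:R `^ (d%:R^-1).

(* The closed cube Lambda_n of volume n centred at the origin. *)
Definition cube (n : nat) : set E :=
  [set x | forall i, - (side n / 2) <= x ord0 i <= side n / 2].

Definition riesz (s : R) (x : E) : \bar R :=
  if x == 0 then +oo%E else (norm2 x `^ (- s))%:E.

End euclidean.

Section configurations.
Context {R : realType} {d : nat}.
Local Notation E := 'rV[R]_d.

Definition locally_finite (A : set E) : Prop :=
  forall B : set E, bounded_set B -> finite_set (A `&` B).

Lemma locally_finiteS (A B : set E) :
  A `<=` B -> locally_finite B -> locally_finite A.
Proof. by move=> AB lB C /lB; apply: sub_finite_set; exact: setSI. Qed.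

Lemma locally_finiteU (A B : set E) :
  locally_finite A -> locally_finite B -> locally_finite (A `|` B).
Proof.
by move=> lA lB C bC; rewrite setIUl finite_setU; split; [exact: lA|exact: lB].
Qed.

Lemma finite_locally_finite (A : set E) : finite_set A -> locally_finite A.
Proof. by move=> fA C _; apply: sub_finite_set fA; exact: subIsetl. Qed.

End configurations.

Record conf (R : realType) (d : nat) := Conf {
  points :> set 'rV[R]_d ;
  points_locally_finite : locally_finite points }.

Section configuration_operations.
Context {R : realType} {d : nat}.
Local Notation E := 'rV[R]_d.
Local Notation C := (conf R d).

Definition conf_seq (s : seq E) : C :=
  Conf (finite_locally_finite (finite_seq s)).

Definition restr (g : C) (D : set E) : C :=
  Conf (locally_finiteS (@subIsetl _ g D) (@points_locally_finite _ _ g)).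

Definition conf_union (g g' : C) : C :=
  Conf (locally_finiteU (@points_locally_finite _ _ g)
                        (@points_locally_finite _ _ g')).

Definition conf_add (g : C) (x : E) : C := conf_union g (conf_seq [:: x]).

Definition conf_del (g : C) (x : E) : C := restr g (~` [set x]).

(* N_D; only meaningful for D bounded. *)
Definition npoints (D : set E) (g : C) : nat := #|` fset_set (g `&` D)|.

(* The events {N_B in Y}, for B a bounded Borel subset of L. *)
Definition count_events (L : set E) : set (set C) :=
  [set A | exists B : set E, exists Y : set nat,
     [/\ bounded_borel B, B `<=` L & A = npoints B @^-1` Y]].

Definition sigma_F (L : set E) : set (set C) := <<s count_events L >>.

End configuration_operations.

Definition conf_display : measure_display. Proof. by constructor. Qed.

Section configuration_space.
Context {R : realType} {d : nat}.
Local Notation C := (conf R d).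

HB.instance Definition _ := gen_eqMixin C.
HB.instance Definition _ := gen_choiceMixin C.
HB.instance Definition _ := isPointed.Build C (conf_seq [::]).
HB.instance Definition _ := @isMeasurable.Build conf_display C
  (sigma_F setT) (@sigma_algebra0 _ setT _) (@sigma_algebraC _ _)
  (@sigma_algebra_bigcup _ setT _).

End configuration_space.

Section point_processes.
Context {R : realType} {d : nat}.
Local Notation E := 'rV[R]_d.
Local Notation C := (conf R d).
Local Open Scope ereal_scope.

Definition conf_tuple (n : nat) (t : n.-tuple E) : C := conf_seq t.

Definition uniform_on (L : set E) : set E -> \bar R :=
  fun A => ((fine (lebesgue_rV L))^-1)%:E * lebesgue_rV (A `&` L).

(* The law of N independent uniform points in L. *)
Definition binomial_process (L : set E) (N : nat) : set C -> \bar R :=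
  pushforward (power_measure (uniform_on L) N) (@conf_tuple N).

(* The Poisson process of intensity 1 in the bounded set D: the number of
   points is Poisson with parameter lambda(D) and, given it, the points are
   independent and uniform in D. The factor lambda(D)^N of the Poisson weight
   is absorbed in the unnormalised measure lambda_D^N, so that the formula is
   also right (the empty configuration) when lambda(D) = 0. *)
Definition poisson_process (D : set E) : set C -> \bar R :=
  fun A => (expR (- fine (lebesgue_rV D)))%:E *
    \sum_(0 <= N <oo) ((N`!%:R^-1)%:E *
      pushforward (power_measure (fun B => lebesgue_rV (B `&` D)) N)
        (@conf_tuple N) A).

Definition local_fun (f : C -> R) : Prop :=
  exists2 D : set E, bounded_borel D &
    forall Y : set R, measurable Y -> sigma_F D (f @^-1` Y).

Definition tame_fun (f : C -> R) : Prop :=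
  exists b : R, exists D : set E, [/\ (0 < b)%R, bounded_borel D &
    forall g, (`|f g| <= b * (1 + (npoints D g)%:R))%R].

(* Convergence of sequences in the local topology, the initial topology of the
   maps P |-> \int f dP for f local and tame. *)
Definition cvg_local (P_ : nat -> set C -> \bar R) (P : set C -> \bar R)
    : Prop :=
  forall f : C -> R, local_fun f -> tame_fun f ->
    \int[P_ k]_g (f g)%:E @[k --> \oo] --> \int[P]_g (f g)%:E.

End point_processes.

Section finite_volume.
Context {R : realType} {d : nat}.
Variables (s beta : R) (n : nat).
Local Notation E := 'rV[R]_d.
Local Notation C := (conf R d).
Local Open Scope ereal_scope.

(* k n^(1/d) *)
Definition lattice_point (k : 'rV[int]_d) : E :=
  (side (d := d) n *: map_mx intr k)%R.

Definition gn_term (x : E) (k : 'rV[int]_d) : \bar R :=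
  riesz s (x + lattice_point k)%R -
  (n%:R^-1)%:E *
    \int[lebesgue_rV]_(y in cube n) riesz s (y + lattice_point k)%R.

(* The series over Z^d converges absolutely, up to a possible term +oo. *)
Definition gn (x : E) : \bar R :=
  \esum_(k in setT) (gn_term x)^\+ k - \esum_(k in setT) (gn_term x)^\- k.

(* gn is even: the sum over unordered pairs is half that over ordered pairs. *)
Definition Hn (g : C) : \bar R :=
  (2^-1)%:E * \sum_(x \in g) \sum_(y \in g `\ x) gn (x - y)%R.

Definition hn (x : E) (g : C) : \bar R := \sum_(y \in g) gn (x - y)%R.

Definition weight_n (g : C) : \bar R := expeR (- (beta%:E * Hn g)).

Definition Zn : \bar R := \int[binomial_process (cube n) n]_g weight_n g.

Definition gibbs_n : set C -> \bar R :=
  fun A => ((fine Zn)^-1)%:E *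
    \int[binomial_process (cube n) n]_(g in A) weight_n g.

End finite_volume.

Section infinite_volume.
Context {R : realType} {d : nat}.
Variables (s beta : R).
Local Notation E := 'rV[R]_d.
Local Notation C := (conf R d).
Local Open Scope ereal_scope.

(* Total in x and g: an arbitrary real if the limit does not exist or is
   infinite. *)
Definition diff_potential (x : E) (g : C) : R :=
  fine (limn (fun p => \sum_(y \in g `&` cube p)
                          (riesz s (y - x)%R - riesz s y))).

Definition h_star (Psi : C -> R) (x : E) (g : C) : R :=
  (diff_potential x g + Psi g)%R.

Definition campbell (P : set C -> \bar R) (f : E * C -> \bar R) : \bar R :=
  \int[P]_g \esum_(x in (g : set E)) f (x, conf_del g x).

(* The characterisation of Psi, which determines it P-almost everywhere. *)
Definition campbell_equation (P : set C -> \bar R) (Psi : C -> R) : Prop :=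
  forall f : E * C -> \bar R, measurable_fun [set: E * C] f ->
    (forall z, 0 <= f z) ->
    campbell P f =
    \int[lebesgue_rV]_x \int[P]_g
      (f (x, g) * (expR (- (beta * h_star Psi x g)))%:E).

(* Energy of the points of r, added to z one after the other. *)
Fixpoint energy_seq (h : E -> C -> R) (r : seq E) (z : C) : R :=
  match r with
  | [::] => 0%R
  | x :: r' => (h x z + energy_seq h r' (conf_add z x))%R
  end.

(* The points of eta are listed in an arbitrary order, fixed by choice; eta is
   meant to be finite. *)
Definition H_star (Psi : C -> R) (D : set E) (eta g : C) : R :=
  energy_seq (h_star Psi) (fset_set eta) (restr g (~` D)).

Definition Z_star (Psi : C -> R) (D : set E) (g : C) : \bar R :=
  \int[poisson_process D]_eta (expR (- (beta * H_star Psi D eta g)))%:E.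

End infinite_volume.

(* Main.v *)
Require Import Defs.
From HB Require Import structures.
From mathcomp Require Import all_boot all_order all_algebra finmap.
From mathcomp Require Import all_classical all_reals all_analysis.
From mathcomp Require Import measurable_realfun.
Import Order.TTheory GRing.Theory Num.Theory.
Import numFieldNormedType.Exports.
Local Open Scope classical_set_scope.
Local Open Scope ring_scope.

(** Everything is derived from the Campbell equation, in which
    [w(x,g) = exp(- beta h(x,g))] is the density for the insertion of a point [x]
    into a configuration [g].  Let [D] be the bounded region and [u(t,g)] the
    product of the weights met when the entries of a tuple [t] are added to [g]
    one after the other.  Iterating the equation [n] times gives
    [[
      E[G; N_D = n] =
        1/n! \int_{D^n} E[u(t,g) G(g + t); N_D(g) = 0] dt
    ]]
    ([n_point_formula]).  Summed over [n], this recovers the whole law from its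
    restriction to the event that [D] is empty ([integral_gibbs_sum]).  When [G]
    depends only on the configuration outside [D], the factor [G] leaves the
    inner integral, and
    [[
      E[k(g outside D)] = E[k(g) z(g); N_D(g) = 0],
      z(g) = \sum_n 1/n! \int_{D^n} u(t,g) dt
    ]]
    ([integral_outside]).  The choice [k = 1] shows that [z] is almost surely
    finite, and the choice of the quotient of
    [\sum_n 1/n! \int_{D^n} u(t,g) G(g + t) dt] by [z], in which [z] cancels,
    is the Gibbs equation ([integral_gibbs_mean]).

    It remains to recognise these series as Poisson integrals.  The energy of a
    finite configuration is a sum along an enumeration fixed by choice, so it
    need not be measurable in the configuration.  The repair is that the
    order is almost surely irrelevant.  The two-point formula counts ordered
    pairs of points and is therefore symmetric, so its density, the weight of
    adding [y] and then [x], is almost everywhere symmetric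
    ([pair_weight_sym_ae]); adjacent transpositions generate all permutations,
    and almost every tuple has an order-free weight
    ([nonexchangeable_mass_ae]).  Off a null set the energy thus agrees with
    the energy along a measurable enumeration of the points ([listing]), and
    two functions equal off a measurable null set have the same integral
    whether or not they are measurable ([integral_off_null],
    [poisson_integral]). *)

Set Implicit Arguments.
Unset Strict Implicit.

(** * Integrals of possibly non-measurable functions; powers of measures *)

Section off_null.
Context d (T : measurableType d) (R : realType).
Variable mu : {measure set T -> \bar R}.
Local Open Scope ereal_scope.
Import HBNNSimple.

Lemma ge0_integral_sup (f : T -> \bar R) : (forall x, 0 <= f x) ->
  \int[mu]_x f x = ereal_sup [set sintegral mu h |
    h in [set h : {nnsfun T >-> R} | forall x, (h x)%:E <= f x]].
Proof. by move=> f0; rewrite ge0_integralTE. Qed.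

(** A simple function below [f] becomes a simple function below [g] once it is
    cut off on [N], and this does not change its integral.  This serves
    integrands that fail to be measurable. *)
Lemma le_integral_off_null (N : set T) (f g : T -> \bar R) :
  measurable N -> mu N = 0 -> (forall x, 0 <= f x) -> (forall x, 0 <= g x) ->
  (forall x, ~ N x -> f x <= g x) -> \int[mu]_x f x <= \int[mu]_x g x.
Proof.
move=> mN N0 f0 g0 fg; rewrite !ge0_integral_sup//.
apply: ge_ereal_sup => _ [h /= hf <-].
have mNC : measurable (~` N) by exact: measurableC.
have -> : sintegral mu h = sintegral mu (h \_ (~` N)).
  have := integral_nnsfun mu measurableT h; rewrite patch_setT => <-.
  have := integral_nnsfun mu mNC h => <-.
  rewrite (@ge0_negligible_integral _ _ _ mu setT N) ?setTD//.
  - by apply/measurable_EFinP; exact: measurable_funTS.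
  - by move=> x _; rewrite lee_fin.
rewrite (mrestrict _ mNC); apply: ereal_sup_ubound => /=.
exists (proj_nnsfun h mNC) => //= x; rewrite mindicE.
have [xN|xN] := pselect (N x).
  by rewrite memNset ?mulr0//= => /(_ xN).
by rewrite mem_set// mulr1 (le_trans (hf x))// fg.
Qed.

Lemma ge0_integral_off_null (N : set T) (f g : T -> \bar R) :
  measurable N -> mu N = 0 -> (forall x, 0 <= f x) -> (forall x, 0 <= g x) ->
  (forall x, ~ N x -> f x = g x) -> \int[mu]_x f x = \int[mu]_x g x.
Proof.
move=> mN N0 f0 g0 fg; apply/eqP.
by rewrite eq_le; apply/andP; split;
  apply: (le_integral_off_null mN) => // x /fg ->.
Qed.

Lemma integral_off_null (N : set T) (f g : T -> \bar R) :
  measurable N -> mu N = 0 ->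
  (forall x, ~ N x -> f x = g x) -> \int[mu]_x f x = \int[mu]_x g x.
Proof.
move=> mN N0 fg; rewrite integralE [RHS]integralE.
by congr (_ - _); apply: (ge0_integral_off_null mN) => // x /fg e;
  rewrite ?funeposE ?funenegE e.
Qed.

End off_null.

Section image_measure.
Context d1 d2 (T1 : measurableType d1) (T2 : measurableType d2) (R : realType).
Variables (m : {measure set T1 -> \bar R}) (f : T1 -> T2).
Hypothesis mf : measurable_fun setT f.
Local Open Scope ereal_scope.

(** This lemma and the two that follow give set functions the structure of a
    (sigma-finite) measure, which Fubini's theorem demands of its arguments. *)
Lemma image_measureP :
  {nu : {measure set T2 -> \bar R} | nu = pushforward m f :> (_ -> _)}.
Proof.
pose nu : {measure set T2 -> \bar R} := HB.pack (pushforward m f).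
by exists (nu mf).
Qed.

End image_measure.

Lemma product_sigma_finite d1 d2 (T1 : measurableType d1)
    (T2 : measurableType d2) (R : realType)
    (m1 : {sigma_finite_measure set T1 -> \bar R})
    (m2 : {sigma_finite_measure set T2 -> \bar R}) :
  sigma_finite setT (m1 \x m2)%E.
Proof.
have /sigma_finiteP[F [TF ndF Foo]] := sigma_finiteT m1.
have /sigma_finiteP[G [TG ndG Goo]] := sigma_finiteT m2.
exists (fun n => F n `*` G n).
  apply/esym/seteqP; split=> // -[x y] _.
  have [i _ Fix] : (\bigcup_i F i) x by rewrite -TF.
  have [j _ Gjy] : (\bigcup_j G j) y by rewrite -TG.
  exists (maxn i j) => //; split => /=.
    by move: x Fix; exact/subsetPset/ndF/leq_maxl.
  by move: y Gjy; exact/subsetPset/ndG/leq_maxr.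
move=> k; have [? ?] := Foo k; have [? ?] := Goo k.
split; first exact: measurableX.
by rewrite product_measure1E// lte_mul_pinfty// ge0_fin_numE.
Qed.

Lemma sigma_finite_pack d (T : measurableType d) (R : realType)
    (nu : {measure set T -> \bar R}) : sigma_finite setT nu ->
  {m : {sigma_finite_measure set T -> \bar R} | m = nu :> (_ -> _)}.
Proof.
move=> sf.
pose H2 := isSFinite.Build _ _ _ _ (sfinite_measure_sigma_finite sf).
pose H3 := isSigmaFinite.Build _ _ _ _ sf.
pose m := HB.pack_for (SigmaFiniteMeasure.type T R) (Measure.sort nu) H2 H3.
by exists m.
Qed.

Section power.
Context d (T : measurableType d) (R : realType).
Variable mu : {sigma_finite_measure set T -> \bar R}.
Local Open Scope ereal_scope.

Let mcons n : measurable_fun [set: T * n.-tuple T]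
  (fun p => [tuple of p.1 :: p.2]).
Proof. exact: measurable_cons. Qed.

Lemma power_measureP n :
  {m : {sigma_finite_measure set (n.-tuple T) -> \bar R} |
    m = @power_measure _ T R mu n :> (_ -> _)}.
Proof.
elim: n => [|n [m mE]] /=.
  by exists [the {sigma_finite_measure set _ -> \bar R} of
    \d_([tuple] : 0.-tuple T)].
have [nu nuE] := image_measureP (mu \x m) (@mcons n).
have sf : sigma_finite setT nu.
  have [F UF Foo] := product_sigma_finite mu m.
  pose un (t : n.+1.-tuple T) := (thead t, [tuple of behead t]).
  have mun : measurable_fun setT un.
    apply/measurable_fun_pairP; split.
      exact: (measurable_tnth ord0).
    exact: measurable_behead.
  have mG k : measurable (un @^-1` F k).
    by rewrite -[X in measurable X]setTI; apply: mun => //; case: (Foo k).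
  exists (fun k => un @^-1` F k).
    by rewrite -preimage_bigcup -UF preimage_setT.
  move=> k; split; first exact: mG.
  rewrite nuE /pushforward -comp_preimage.
  set Fk := (_ @^-1` _).
  suff -> : Fk = F k by case: (Foo k).
  rewrite {}/Fk; apply/seteqP; split => -[x t]; rewrite /preimage /= /un theadE.
    by move=> h; rewrite [X in (_, X)](_ : _ = t) in h; [|exact/val_inj].
  by move=> h; rewrite [X in (_, X)](_ : _ = t); [|exact/val_inj].
have [nu' nu'E] := sigma_finite_pack sf.
by exists nu'; rewrite nu'E nuE -mE.
Qed.

(** The set function [power_measure], with the sigma-finiteness that is needed to
    integrate over one coordinate after the other. *)
Definition power n : {sigma_finite_measure set (n.-tuple T) -> \bar R} :=
  sval (power_measureP n).

Lemma powerE n : power n = @power_measure _ T R mu n :> (_ -> _).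
Proof. exact: svalP (power_measureP n). Qed.

Lemma ge0_integral_power0 (f : 0.-tuple T -> \bar R) :
  measurable_fun setT f -> (forall t, 0 <= f t) ->
  \int[power 0]_t f t = f [tuple].
Proof.
by move=> mf f0; rewrite powerE/= integral_dirac// diracT mul1e.
Qed.

Lemma powerSE n : power n.+1 = pushforward (mu \x power n)
  (fun p : T * n.-tuple T => [tuple of p.1 :: p.2]) :> (_ -> _).
Proof. by rewrite powerE/= -powerE. Qed.

Lemma ge0_integral_powerS n (f : n.+1.-tuple T -> \bar R) :
  measurable_fun setT f -> (forall t, 0 <= f t) ->
  \int[power n.+1]_t f t =
  \int[mu]_x \int[power n]_t f [tuple of x :: t].
Proof.
move=> mf f0; rewrite powerSE ge0_integral_pushforward//.
rewrite preimage_setT fubini_tonelli1//=.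
  exact: (measurableT_comp mf (@mcons n)).
exact: mcons.
Qed.

End power.

(** * Borel sets and Lebesgue measure of R^d *)

Section borel.
Context {R : realType} {d : nat}.
Local Notation E := 'rV[R]_d.

Lemma measurable_coord (i : 'I_d) : measurable_fun setT (fun x : E => x ord0 i).
Proof.
apply: (measurability _ (RGenOInfty.measurableE R)) => _ [_ [a ->] <-].
rewrite setTI; apply: sub_sigma_algebra.
have /continuousP := @coord_continuous R 1 d ord0 i; apply.
exact: interval_open.
Qed.

Lemma le_coord_norm (x : E) (i : 'I_d) : `|x ord0 i| <= `|x|.
Proof.
have /mapP[j Hj ->] : `|x ord0 i| \in [seq `|x y.1 y.2| | y : 'I_1 * 'I_d].
  by apply/mapP; exists (ord0, i) => //=; rewrite mem_enum.
by rewrite [leRHS]/Num.Def.normr /= mx_normrE; apply/bigmax_geP; right => /=; exists j.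
Qed.

Lemma bounded_setP (A : set E) :
  bounded_set A -> exists2 M : R, 0 <= M & forall x i, A x -> `|x ord0 i| <= M.
Proof.
move=> /ex_strict_bound_gt0[M M0 AM]; exists M; first exact: ltW.
by move=> x i /AM /ltW; apply: le_trans; exact: le_coord_norm.
Qed.

(** At each scale [k] there are only countably many cells, they cover the space,
    and their diameter tends to [0] as [k] grows.  They reduce topological
    statements on points to countably many conditions. *)
Definition cell (c : {ffun 'I_d -> rat}) (k : nat) : set E :=
  [set x | forall i, `|x ord0 i - ratr (c i)| < k.+1%:R^-1].

Lemma mem_cell (x : E) (k : nat) : exists c, cell c k x.
Proof.
have q i : {q : rat | `|x ord0 i - ratr q| < k.+1%:R^-1}.
  apply/cid; have : x ord0 i - k.+1%:R^-1 < x ord0 i + k.+1%:R^-1.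
    by rewrite ltrBlDr -addrA ltrDl addr_gt0// invr_gt0.
  move=> /rat_in_itvoo[q]; rewrite in_itv/= => qi.
  by exists q; rewrite distrC ltr_distl.
by exists [ffun i => sval (q i)] => i; rewrite ffunE; exact: (svalP (q i)).
Qed.

Lemma cell_ball (x y : E) c k (e : R) : 0 < e -> 2 / e < k%:R ->
  cell c k x -> cell c k y -> ball x e y.
Proof.
move=> e0 ke cx cy; split => // i j; rewrite ord1 /ball/=.
have {}ke : 2 * k.+1%:R^-1 < e.
  rewrite ltr_pdivrMr ?ltr0n// mulrC -ltr_pdivrMr//.
  by rewrite (lt_le_trans ke)// ler_nat.
rewrite -[x ord0 j](subrK (ratr (c j))) -addrA.
rewrite (le_lt_trans (ler_normD _ _))// (le_lt_trans _ ke)//.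
rewrite mulr_natl mulr2n lerD// ltW//.
by have := cy j; rewrite distrC.
Qed.

Definition row_of_tuple (t : d.-tuple (measurableTypeR R)) : E :=
  \row_i tnth t i.

(** An open set is the countable union of the cells that it contains, and the
    tuples that land in a cell form a product of intervals. *)
Lemma measurable_row_of_tuple : measurable_fun setT row_of_tuple.
Proof.
apply: (measurability _ (erefl (@measurable _ E))) => _ [U oU <-].
rewrite setTI.
have -> : U = \bigcup_(p in [set p : {ffun 'I_d -> rat} * nat |
    cell p.1 p.2 `<=` U]) cell p.1 p.2.
  apply/seteqP; split=> [x Ux|x [p]]; last exact.
  have /nbhs_ballP[e /= e0 xeU] : nbhs x U by exact: open_nbhs_nbhs.
  have [c cx] := mem_cell x (Num.truncn (2 / e)).+1.
  exists (c, (Num.truncn (2 / e)).+1) => //= y cy.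
  by apply: xeU; apply: cell_ball cx cy => //; rewrite truncnS_gt.
rewrite preimage_bigcup bigcup_mkcond.
apply: countable_bigcupT_measurable => // -[c k].
case: ifPn => // _.
rewrite (_ : _ @^-1` _ =
    \bigcap_(i in [set: 'I_d])
      ((fun t : d.-tuple (measurableTypeR R) => tnth t i) @^-1`
        (ball (ratr (c i) : R) k.+1%:R^-1))).
  apply: fin_bigcap_measurable => // i _.
  rewrite -[X in measurable X]setTI; apply: (measurable_tnth i) => //.
  exact: measurable_ball.
apply/seteqP; split=> t /=.
  by move=> + i _ => /(_ i); rewrite /ball/= mxE distrC.
by move=> + i => /(_ i I); rewrite /ball/= mxE distrC.
Qed.

End borel.

Section lebesgue.
Context {R : realType} {d : nat}.
Local Notation E := 'rV[R]_d.
Local Open Scope ereal_scope.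

Lemma lebesgue_rVP : {m : {measure set E -> \bar R} |
  m = @lebesgue_rV R d :> (_ -> _)}.
Proof.
have [m mE] := image_measureP
  (power (@lebesgue_measure R : {sigma_finite_measure set (measurableTypeR R) -> \bar R}) d)
  (@measurable_row_of_tuple R d).
by exists m; rewrite mE /lebesgue_rV -powerE.
Qed.

Lemma measurable_tuple_box n (M : R) : measurable
  [set t : n.-tuple (measurableTypeR R) | forall i, (`|tnth t i| <= M)%R].
Proof.
rewrite (_ : [set _ | _] = \bigcap_(i in [set: 'I_n])
    ((fun t : n.-tuple (measurableTypeR R) => tnth t i) @^-1` `[(- M)%R, M])).
  apply: fin_bigcap_measurable => // i _.
  by rewrite -[X in measurable X]setTI; exact: (measurable_tnth i).
apply/seteqP; split=> t /=.
  by move=> + i _ => /(_ i); rewrite /= in_itv/= ler_norml.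
by move=> + i => /(_ i I); rewrite /= in_itv/= ler_norml.
Qed.

Lemma power_lebesgue_box_fin n (M : R) :
  power (@lebesgue_measure R : {sigma_finite_measure set (measurableTypeR R) -> \bar R}) n
    [set t : n.-tuple (measurableTypeR R) | forall i, (`|tnth t i| <= M)%R]
  < +oo.
Proof.
elim: n => [|n IH].
  rewrite powerE/= diracE; case: (_ \in _) => //; exact: ltry.
set B := [set _ | _] in IH.
rewrite powerSE /pushforward/=.
rewrite (_ : _ @^-1` _ = `[(- M)%R, M] `*` B).
  rewrite product_measure1E//.
    have Moo : lebesgue_measure `[(- M)%R, M] < +oo.
      rewrite lebesgue_measure_itv/=; case: ifP => // _.
      by rewrite -EFinD ltry.
    by rewrite lte_mul_pinfty// ge0_fin_numE.
  exact: measurable_tuple_box.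
apply/seteqP; split=> -[x t] /=.
  move=> h; split.
    by have := h ord0; rewrite (tnth_nth 0%R)/= in_itv/= ler_norml.
  by move=> i; have := h (lift ord0 i); rewrite tnthS.
move=> [xM tM] i; case: (unliftP ord0 i) => [j ->|->].
  by rewrite tnthS; exact: tM.
by rewrite (tnth_nth 0%R)/=; move: xM; rewrite in_itv/= ler_norml.
Qed.

Lemma lebesgue_rV_fin (A : set E) : bounded_borel A -> lebesgue_rV A < +oo.
Proof.
move=> [mA /bounded_setP[M M0 AM]].
rewrite /lebesgue_rV -powerE.
apply: le_lt_trans (power_lebesgue_box_fin d M).
rewrite /pushforward le_measure ?inE//.
- by rewrite -[X in measurable X]setTI; exact: measurable_row_of_tuple.
- exact: measurable_tuple_box.
- by move=> t /= At i; have := AM _ i At; rewrite mxE.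
Qed.

End lebesgue.

(** * Configurations and their sigma-algebra *)

Lemma measurable_in d1 (T : measurableType d1) (A : set T) :
  measurable A -> measurable_fun setT (fun x => x \in A).
Proof.
move=> mA; apply: (measurable_fun_bool true); rewrite setTI.
by rewrite (_ : _ @^-1` _ = A)//; apply/seteqP; split=> x /= => [/set_mem|/mem_set].
Qed.

Lemma measurable_boolset d1 (T : measurableType d1) (b : T -> bool) :
  measurable_fun setT b -> measurable [set x | b x].
Proof.
by move=> mb; have := mb measurableT [set true]; rewrite setTI; apply.
Qed.

Section conf_basics.
Context {R : realType} {d : nat}.
Local Notation E := 'rV[R]_d.
Local Notation C := (conf R d).

Lemma conf_ext (g g' : C) : (g : set E) = g' -> g = g'.
Proof.
case: g g' => A lA [B lB] /= AB; rewrite AB in lA *.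
by congr Conf; exact: Prop_irrelevance.
Qed.

Lemma bounded_set_norm (A : set E) (M : R) :
  (forall x, A x -> `|x| <= M) -> bounded_set A.
Proof.
move=> AM; exists M; split; first exact: num_real.
by move=> N MN x /AM/= xM; rewrite (le_trans xM)// ltW.
Qed.

Lemma bounded_setS (A B : set E) : A `<=` B -> bounded_set B -> bounded_set A.
Proof.
move=> AB /ex_strict_bound_gt0[M _ BM].
by apply: (@bounded_set_norm _ M) => x /AB /BM /ltW.
Qed.

Lemma bounded_set_box (A : set E) (M : R) :
  (forall x i, A x -> `|x ord0 i| <= M) -> bounded_set A.
Proof.
move=> AM; apply: (@bounded_set_norm _ (Num.max 0 M)) => x Ax.
rewrite [leLHS]/Num.Def.normr /= mx_normrE; apply/bigmax_leP; split.
  by rewrite le_max lexx.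
by move=> [i j] _ /=; rewrite ord1 le_max AM ?orbT.
Qed.

Lemma bounded_borelI (A D : set E) :
  measurable D -> bounded_borel A -> bounded_borel (D `&` A).
Proof.
move=> mD [mA bA]; split; first exact: measurableI.
by apply: bounded_setS bA; exact: subIsetr.
Qed.

Lemma finite_conf (B : set E) (g : C) : bounded_set B -> finite_set (g `&` B).
Proof. by move=> bB; exact: points_locally_finite. Qed.

Lemma npoints_gt0 (B : set E) (g : C) : bounded_set B ->
  (0 < npoints B g)%N <-> exists2 x, points g x & B x.
Proof.
move=> bB; have fB := finite_conf g bB; rewrite /npoints cardfs_gt0; split.
  by case/fset0Pn => x; rewrite in_fset_set// in_setE => -[]; exists x.
by move=> [x gx Bx]; apply/fset0Pn; exists x; rewrite in_fset_set// in_setE.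
Qed.

Lemma npoints0 (B : set E) (g : C) : bounded_set B ->
  npoints B g = 0%N <-> g `&` B = set0.
Proof.
move=> bB; split=> [|gB]; last by rewrite /npoints gB fset_set0 cardfs0.
move=> N0; apply/seteqP; split=> // x [gx Bx].
have : (0 < npoints B g)%N by apply/npoints_gt0 => //; exists x.
by rewrite N0.
Qed.

Lemma npoints_restr (B D : set E) (g : C) :
  npoints B (restr g D) = npoints (D `&` B) g.
Proof. by rewrite /npoints /= setIA. Qed.

Lemma npoints_add (B : set E) (g : C) (x : E) : bounded_set B ->
  npoints B (conf_add g x) =
  (npoints B g + ((x \in B) && ~~ (x \in (g : set E))))%N.
Proof.
move=> bB; have fB := finite_conf g bB; rewrite /npoints /=.
rewrite setIUl; have [xB|xB] := boolP (x \in B); last first.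
  rewrite (_ : [set` [:: x]] `&` B = set0) ?setU0 ?addn0//.
  apply/seteqP; split=> // y [/=]; rewrite inE => /eqP -> xB'.
  by move: xB; rewrite notin_setE.
rewrite (_ : [set` [:: x]] `&` B = [set x]); last first.
  apply/seteqP; split=> y /=; rewrite inE; first by move=> -[/eqP].
  by move=> ->; split => //; exact/set_mem.
rewrite setUC fset_setU1// cardfsU1 addnC; congr (_ + nat_of_bool _)%N.
rewrite in_fset_set//=; congr negb; apply/idP/idP; rewrite !in_setE.
  by move=> [].
by move=> gx; split => //; exact/set_mem.
Qed.

Lemma npoints_del (B : set E) (g : C) (x : E) : bounded_set B ->
  npoints B (conf_del g x) =
  (npoints B g - ((x \in B) && (x \in (g : set E))))%N.
Proof.
move=> bB; have fB := finite_conf g bB; rewrite /npoints /=.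
rewrite setIAC -setDE fset_setD1//.
rewrite [#|` fset_set (_ `&` B)|](cardfsD1 x) in_fset_set//.
rewrite (_ : x \in g `&` B = (x \in B) && (x \in (g : set E))) ?addKn//.
apply/idP/andP; rewrite !in_setE; first by move=> [].
by move=> [].
Qed.

Lemma conf_addK (g : C) (x : E) : points g x -> conf_add (conf_del g x) x = g.
Proof.
move=> gx; apply: conf_ext; apply/seteqP; split=> y /=.
  by move=> [[]//|]; rewrite inE => /eqP ->.
by have [->|yx] := eqVneq y x; [right; rewrite inE|left; split => //; exact/eqP].
Qed.

Lemma measurable_npoints (B : set E) : bounded_borel B ->
  measurable_fun setT (npoints B : C -> nat).
Proof.
move=> bB _ Y _; rewrite setTI; apply: sub_sigma_algebra.
by exists B, Y.
Qed.

(** The sigma-algebra on configurations is generated by the counting maps. *)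
Lemma measurable_fun_conf d1 (T : measurableType d1) (f : T -> C) :
  (forall B : set E, bounded_borel B ->
    measurable_fun setT (fun t => npoints B (f t))) ->
  measurable_fun setT f.
Proof.
move=> mf; apply: (measurability _ (erefl (@measurable _ C))).
move=> _ [_ [B [Y [bB _ ->]]] <-].
by apply: (mf B bB).
Qed.

Lemma measurable_restr (D : set E) : measurable D ->
  measurable_fun setT (fun g : C => restr g D).
Proof.
move=> mD; apply: measurable_fun_conf => B bB.
under eq_fun do rewrite npoints_restr.
by apply: measurable_npoints; exact: bounded_borelI.
Qed.

Lemma bounded_borel_cell c k : bounded_borel (cell c k : set E).
Proof.
split.
  rewrite (_ : (cell c k : set E) = \bigcap_(i in [set: 'I_d])
      ((fun x : E => x ord0 i) @^-1` (ball (ratr (c i) : R) k.+1%:R^-1))).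
    apply: fin_bigcap_measurable => // i _.
    rewrite -[X in measurable X]setTI; apply: (measurable_coord i) => //.
    exact: measurable_ball.
  apply/seteqP; split=> t /=.
    by move=> + i _ => /(_ i); rewrite /ball/= distrC.
  by move=> + i => /(_ i I); rewrite /ball/= distrC.
apply: (@bounded_set_box _ (\sum_i `|ratr (c i)| + 1)) => x i /(_ i) xi.
rewrite -[x ord0 i](subrK (ratr (c i))) addrC (le_trans (ler_normD _ _))//.
rewrite lerD//.
  by rewrite (bigD1 i)//= lerDl sumr_ge0.
by rewrite (le_trans (ltW xi))// invf_le1// ler1n.
Qed.

(** By local finiteness the points of [g] other than [x] keep a distance from
    [x]; a cell smaller than this distance that contains both [x] and a point of
    [g] shows that [x] is a point of [g].  This writes membership in terms of
    countably many counting maps, hence the measurability of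
    adding and deleting a point. *)
Lemma mem_confP (x : E) (g : C) :
  points g x <-> forall k, exists c, cell c k x /\ (0 < npoints (cell c k) g)%N.
Proof.
split=> [gx k|gk].
  have [c cx] := mem_cell x k; exists c; split=> //.
  by apply/npoints_gt0; [case: (bounded_borel_cell c k)|exists x].
apply: contrapT => ngx.
have fB : finite_set (g `&` ball x 1).
  apply: finite_conf; apply: (@bounded_set_norm _ (`|x| + 1)) => y /=.
  rewrite -ball_normE/= => xy; rewrite -[y](subrK x) addrC.
  by rewrite (le_trans (ler_normD _ _))// lerD2l distrC ltW.
have cl := accessible_finite_set_closed.1 (hausdorff_accessible
  (@norm_hausdorff _ E)) _ fB.
have /nbhs_ballP[e /= e0 xe] : nbhs x (~` (g `&` ball x 1)).
  by apply: open_nbhs_nbhs; split; [exact: closed_openC|move=> []].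
pose e' := Num.min e 1.
have e'0 : 0 < e' by rewrite lt_min e0 ltr01.
pose k := (Num.truncn (2 / e')).+1.
have [c [cx /npoints_gt0]] := gk k.
case; first by case: (bounded_borel_cell c k).
move=> y gy cy; have xy : ball x e' y.
  by apply: cell_ball cx cy => //; rewrite truncnS_gt.
apply: (xe y); first by apply: le_ball xy; rewrite ge_min lexx.
by split => //; apply: le_ball xy; rewrite ge_min lexx orbT.
Qed.

Lemma measurable_mem_conf :
  measurable [set p : E * C | points p.2 p.1].
Proof.
rewrite (_ : [set _ | _] = \bigcap_k \bigcup_c
   (cell c k `*` [set g : C | (0 < npoints (cell c k) g)%N])).
  apply: bigcapT_measurable => k; apply: countable_bigcupT_measurable => // c.
  have bc := bounded_borel_cell c k.
  apply: measurableX; first by case: bc.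
  apply: measurable_boolset; apply: measurable_fun_ltn => //.
  exact: measurable_npoints.
apply/seteqP; split=> -[x g] /=.
  by move=> /mem_confP + k _ => /(_ k)[c [cx N0]]; exists c.
by move=> h; apply/mem_confP => k; have [c _ [/= cx N0]] := h k I; exists c.
Qed.

Lemma measurable_in_conf :
  measurable_fun setT (fun p : E * C => p.1 \in (p.2 : set E)).
Proof.
rewrite (_ : (fun _ => _) = fun p => p \in [set p : E * C | points p.2 p.1]).
  by apply: measurable_in; exact: measurable_mem_conf.
by apply/funext => p; apply/idP/idP; rewrite !in_setE.
Qed.

Lemma measurable_nat_of_bool d1 (T : measurableType d1) (b : T -> bool) :
  measurable_fun setT b -> measurable_fun setT (fun x => nat_of_bool (b x)).
Proof.
move=> mb; rewrite (_ : (fun _ => _) = fun x => if b x then 1%N else 0%N).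
  exact: measurable_fun_ifT.
by apply/funext => x; case: (b x).
Qed.

Lemma measurable_conf_add :
  measurable_fun setT (fun p : E * C => conf_add p.2 p.1).
Proof.
apply: measurable_fun_conf => B bB.
under eq_fun do rewrite (npoints_add _ _ bB.2).
apply: measurable_fun_addn.
  by apply: measurableT_comp => //; exact: measurable_npoints.
apply: measurable_nat_of_bool; apply: measurable_and.
  by apply: (measurableT_comp (measurable_in bB.1)).
by apply: measurable_neg; exact: measurable_in_conf.
Qed.

Lemma measurable_conf_del :
  measurable_fun setT (fun p : E * C => conf_del p.2 p.1).
Proof.
apply: measurable_fun_conf => B bB.
under eq_fun do rewrite (npoints_del _ _ bB.2).
apply: measurable_fun_subn.
  by apply: measurableT_comp => //; exact: measurable_npoints.
apply: measurable_nat_of_bool; apply: measurable_and.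
  by apply: (measurableT_comp (measurable_in bB.1)).
exact: measurable_in_conf.
Qed.

End conf_basics.

(** * A measurable enumeration of the points in a bounded set *)

Lemma measurable_fun_natcase d1 d2 (T : measurableType d1)
    (U : measurableType d2) (N : T -> nat) (f : nat -> T -> U) :
  measurable_fun setT N -> (forall n, measurable_fun setT (f n)) ->
  measurable_fun setT (fun t => f (N t) t).
Proof.
move=> mN mf _ Y mY; rewrite setTI.
rewrite (_ : _ @^-1` _ = \bigcup_n (N @^-1` [set n] `&` f n @^-1` Y)).
  apply: bigcupT_measurable => n; apply: measurableI.
    by rewrite -[X in measurable X]setTI; exact: mN.
  by rewrite -[X in measurable X]setTI; exact: mf.
apply/seteqP; split=> t /=; first by exists (N t).
by move=> [n _ [/= <-]].
Qed.

Section selection.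
Context {R : realType} {d : nat}.
Local Notation E := 'rV[R]_d.
Local Notation C := (conf R d).

(** Countably many half-spaces, indexed by an axis and a rational threshold; two
    distinct points are separated by one of them. *)
Definition half_space (n : nat) : set E :=
  if (choice.unpickle n : option ('I_d * rat)) is Some p
  then [set x | x ord0 p.1 < ratr p.2] else set0.

Lemma measurable_half_space n : measurable (half_space n).
Proof.
rewrite /half_space; case: choice.unpickle => [[i q]|//] /=.
rewrite [X in measurable X](_ : _ =
    (fun x : E => x ord0 i) @^-1` `]-oo, ratr q[).
  by rewrite -[X in measurable X]setTI; apply: (measurable_coord i).
by apply/seteqP; split=> x /=; rewrite in_itv.
Qed.

Lemma half_spaces_separate (x y : E) :
  (forall n, half_space n x <-> half_space n y) -> x = y.
Proof.
move=> xy; apply/rowP => i; apply/eqP; apply/negPn/negP.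
rewrite neq_lt => /orP[] /rat_in_itvoo[q]; rewrite in_itv/= => /andP[h1 h2].
  have := xy (choice.pickle (i, q)); rewrite /half_space choice.pickleK/= => -[/(_ h1) + _].
  by rewrite ltNge (ltW h2).
have := xy (choice.pickle (i, q)); rewrite /half_space choice.pickleK/= => -[_ /(_ h1)].
by rewrite ltNge (ltW h2).
Qed.

Variable Q : set E.
Hypothesis bQ : bounded_borel Q.

(** Bisection of [Q] by the half-spaces, which keeps a half that contains a point
    of [g].  If there is one in [Q], the intersection of all stages contains
    exactly one point of [g]: at least one because [g] has finitely many points
    in [Q], and at most one because the half-spaces separate points. *)
Fixpoint descent (g : C) (n : nat) : set E :=
  if n is m.+1 then
    if (0 < npoints (half_space m `&` descent g m) g)%N
    then half_space m `&` descent g m else ~` half_space m `&` descent g m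
  else Q.

Lemma descentS g n : descent g n.+1 `<=` descent g n.
Proof. by rewrite /=; case: ifP => _; exact: subIsetr. Qed.

Lemma descent_le g m n : (m <= n)%N -> descent g n `<=` descent g m.
Proof.
elim: n => [|n IH]; first by rewrite leqn0 => /eqP ->.
rewrite leq_eqVlt => /predU1P[->//|/IH].
by apply: subset_trans; exact: descentS.
Qed.

Lemma descent_sub g n : descent g n `<=` Q.
Proof. exact: (@descent_le g 0). Qed.

Lemma descent_bounded g n (D : set E) : bounded_set (D `&` descent g n).
Proof.
apply: bounded_setS bQ.2.
exact: subset_trans (@subIsetr _ _ _) (@descent_sub g n).
Qed.

(** The set [descent g n] depends on [g], but only through finitely many counts,
    so the count in it is a finite case distinction between counting maps. *)
Lemma measurable_npoints_descent n (D : set E) : measurable D ->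
  measurable_fun setT (fun g : C => npoints (D `&` descent g n) g).
Proof.
elim: n D => [|n IH] D mD.
  by rewrite /=; apply: measurable_npoints; exact: bounded_borelI.
rewrite (_ : (fun _ => _) = fun g => if (0 < npoints (half_space n `&` descent g n) g)%N
   then npoints ((D `&` half_space n) `&` descent g n) g
   else npoints ((D `&` ~` half_space n) `&` descent g n) g); last first.
  by apply/funext => g /=; case: ifP => _; rewrite setIA.
have mS := measurable_half_space n.
apply: measurable_fun_ifT.
- by apply: (measurable_fun_ltn _ (IH _ mS)).
- exact: (IH _ (measurableI _ _ mD mS)).
- exact: (IH _ (measurableI _ _ mD (measurableC mS))).
Qed.

Lemma descent_gt0 g : (0 < npoints Q g)%N ->
  forall n, exists2 x, points g x & descent g n x.
Proof.
move=> N0; elim=> [|n [x gx Ax]]; first exact/npoints_gt0/N0/bQ.2.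
rewrite /=; case: ifP => [/npoints_gt0|].
  by apply; exact: descent_bounded.
move=> Sn; exists x => //; split => // Sx.
suff : (0 < npoints (half_space n `&` descent g n) g)%N by rewrite Sn.
by apply/npoints_gt0; [exact: descent_bounded|exists x].
Qed.

(** A point of [g] in [F 0] that is not in every [F n] is lost at some stage; as
    there are finitely many such points, all of them would be lost at the
    largest of these stages. *)
Lemma nested_conf (g : C) (F : nat -> set E) : bounded_set (F 0%N) ->
  (forall m n, (m <= n)%N -> F n `<=` F m) ->
  (forall n, exists2 x, points g x & F n x) ->
  exists2 x, points g x & forall n, F n x.
Proof.
move=> bF Fle Fn; apply: contrapT => noF.
have fA := finite_conf g bF.
have h x : exists n, points g x -> ~ F n x.
  have [gx|ngx] := pselect (points g x); last by exists 0%N.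
  apply: contrapT => hn; apply: noF; exists x => // n.
  by apply: contrapT => nF; apply: hn; exists n.
pose k x := sval (cid (h x)).
pose N := \max_(x <- fset_set (points g `&` F 0%N)) k x.
have [x gx Fx] := Fn N.
have F0x : F 0%N x by apply: (Fle 0%N N).
have := svalP (cid (h x)) gx; apply; apply: (Fle _ N) Fx.
apply: (@leq_bigmax_seq _ _ _ _ x) => //.
by rewrite in_fset_set// inE.
Qed.

Definition select (g : C) : E :=
  xget 0 [set x | points g x /\ forall n, descent g n x].

Lemma descent_inj g x y : (forall n, descent g n x) ->
  (forall n, descent g n y) -> x = y.
Proof.
move=> hx hy; apply: half_spaces_separate => n; have := hx n.+1; have := hy n.+1.
by rewrite /=; case: ifP => _ [? _] [? _].
Qed.

Lemma selectP g : (0 < npoints Q g)%N ->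
  points g (select g) /\ forall n, descent g n (select g).
Proof.
move=> N0; rewrite /select; case: xgetP => [y -> //|noP].
have [x gx hx] := nested_conf bQ.2 (@descent_le g) (descent_gt0 N0).
by exfalso; exact: (noP x (conj gx hx)).
Qed.

Lemma select_in g : (0 < npoints Q g)%N -> points g (select g) /\ Q (select g).
Proof. by move=> /selectP[gx /(_ 0%N)]. Qed.

(** The selected point lies in [D] exactly when every stage of the bisection has
    a point of [g] in [D]. *)
Lemma measurable_select : measurable_fun setT select.
Proof.
move=> _ D mD; rewrite setTI.
have mN (B : set E) : measurable B -> forall n,
    measurable [set g : C | (0 < npoints (B `&` descent g n) g)%N].
  move=> mB n; apply: measurable_boolset; apply: measurable_fun_ltn => //.
  exact: measurable_npoints_descent.
have mQ : measurable [set g : C | (0 < npoints Q g)%N].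
  apply: measurable_boolset; apply: measurable_fun_ltn => //.
  exact: measurable_npoints.
rewrite (_ : _ @^-1` _ =
  ([set g | (0 < npoints Q g)%N] `&`
     \bigcap_n [set g | (0 < npoints (D `&` descent g n) g)%N]) `|`
  (~` [set g | (0 < npoints Q g)%N] `&` [set g | D 0])).
  apply: measurableU.
    by apply: measurableI => //; apply: bigcapT_measurable => n; exact: mN.
  apply: measurableI; first exact: measurableC.
  have [D0|D0] := pselect (D 0).
    by rewrite (_ : [set _ | _] = setT)//; apply/seteqP; split.
  by rewrite (_ : [set _ | _] = set0)//; apply/seteqP; split.
apply/seteqP; split=> g /=.
  have [N0 Dx|N0] := boolP (0 < npoints Q g)%N; last first.
    rewrite /select xgetPN; first by right; split => //; exact/negP.
    move=> x [gx /(_ 0%N) Qx]; apply/negP: N0; rewrite negbK.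
    by apply/npoints_gt0; [exact: bQ.2|exists x].
  have [gx hx] := selectP N0.
  left; split => // n _ /=; apply/npoints_gt0; first exact: descent_bounded.
  by exists (select g).
move=> [[N0 h]|[N0 D0]]; last first.
  rewrite /select xgetPN// => x [gx /(_ 0%N) Qx]; apply: N0.
  by apply/npoints_gt0; [exact: bQ.2|exists x].
have [] := @nested_conf g (fun n => D `&` descent g n).
- exact: descent_bounded.
- by move=> m n mn; apply: setIS; exact: descent_le.
- by move=> n; apply/npoints_gt0; [exact: descent_bounded|exact: (h n)].
move=> x gx hx; have [gy hy] := selectP N0.
by rewrite (@descent_inj g (select g) x)//; [case: (hx 0%N)|move=> n; case: (hx n)].
Qed.

(** The points of [g] in [Q], selected and deleted one by one; the length [n] is
    meant to be their number. *)
Fixpoint listing (n : nat) (g : C) : n.-tuple E :=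
  match n with
  | 0 => [tuple]
  | m.+1 => [tuple of select g :: listing m (conf_del g (select g))]
  end.

Lemma measurable_listing n : measurable_fun setT (listing n).
Proof.
elim: n => [|n IH] /=; first exact: measurable_cst.
apply: measurable_cons; first exact: measurable_select.
apply: (measurableT_comp IH).
have mp : measurable_fun setT (fun g : C => (select g, g)).
  by apply: measurable_fun_pair => //; exact: measurable_select.
exact: (measurableT_comp measurable_conf_del mp).
Qed.

Lemma listingP n (g : C) : npoints Q g = n ->
  uniq (listing n g) /\ [set` (listing n g : seq E)] = points g `&` Q.
Proof.
elim: n g => [|n IH] g Ng /=.
  split=> //; rewrite set_nil; apply/esym/npoints0 => //; exact: bQ.2.
have [gx Qx] : points g (select g) /\ Q (select g).
  by apply: select_in; rewrite Ng.
have [|u ue] := IH (conf_del g (select g)).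
  rewrite npoints_del; last exact: bQ.2.
  by rewrite !mem_set//= Ng subn1.
have mE y : y \in (listing n (conf_del g (select g)) : seq E) =
    (y \in (points g `&` Q) `\ select g).
  apply/idP/idP.
    move=> h; apply/mem_set.
    have : [set` (listing n (conf_del g (select g)) : seq E)] y by [].
    by rewrite ue => -[[]].
  move=> /set_mem[[gy Qy] ny].
  suff : [set` (listing n (conf_del g (select g)) : seq E)] y by [].
  by rewrite ue.
split.
  by rewrite u andbT mE; apply/negP => /set_mem[_]; apply.
apply/seteqP; split=> y /=; rewrite inE mE.
  by move=> /predU1P[->//|/set_mem[]].
move=> [gy Qy]; have [->//|yx] := eqVneq y (select g).
by apply/mem_set; split => //; exact/eqP.
Qed.

Lemma fsbig_listing (F : E -> \bar R) (g : C) :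
  (\sum_(y \in points g `&` Q) F y =
   \sum_(y <- listing (npoints Q g) g) F y)%E.
Proof.
have [u e] := listingP (erefl (npoints Q g)).
by rewrite [RHS]fsbig_seq// -e.
Qed.

End selection.

(** * Measurability of the local energy *)

Section measurable_limn.
Context d (T : measurableType d) (R : realType).
Local Open Scope ereal_scope.

Lemma cvgn_einf_esup (u : (\bar R)^nat) : limn_einf u = limn_esup u -> cvgn u.
Proof.
move=> ul; apply/cvg_ex; exists (limn_esup u).
apply: (@squeeze_cvge _ _ _ _ (einfs u) _ (esups u)).
- near=> n; apply/andP; split.
    by apply: ereal_inf_lbound; exists n => /=.
  by apply: ereal_sup_ubound; exists n => /=.
- by rewrite -ul limn_einf_lim; exact: is_cvg_einfs.
- by rewrite limn_esup_lim; exact: is_cvg_esups.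
Unshelve. all: by end_near. Qed.

(** The limit is the superior limit where this agrees with the inferior limit,
    and a default value elsewhere. *)
Lemma measurable_fun_limn (f : (T -> \bar R)^nat) :
  (forall n, measurable_fun setT (f n)) ->
  measurable_fun setT (fun x => limn (f ^~ x)).
Proof.
move=> mf.
have mes : measurable_fun setT (fun x => limn_esup (f ^~ x)).
  exact: measurable_fun_limn_esup.
have mei : measurable_fun setT (fun x => limn_einf (f ^~ x)).
  rewrite (_ : (fun _ => _) = fun x => - limn_esup (fun n => - f n x)).
    apply: measurableT_comp => //.
    by apply: measurable_fun_limn_esup => n; exact: measurableT_comp.
  by apply/funext => x; rewrite -limn_einfN; congr limn_einf; apply/funext => n;
    rewrite /= oppeK.
pose A := [set x | limn_einf (f ^~ x) = limn_esup (f ^~ x)].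
have mA : measurable A.
  have := measurable_eqe measurableT mei mes; rewrite setTI.
  exact.
rewrite (_ : (fun _ => _) = fun x => if x \in A then limn_esup (f ^~ x) else
   point); last first.
  apply/funext => x; case: ifPn => [/set_mem Ax|/negP nAx].
    by rewrite is_cvg_limn_esupE//; exact: cvgn_einf_esup.
  apply: dvgP => /cvg_ex[y fy]; apply: nAx.
  by apply/mem_set; have [e1 e2] := cvg_limn_einf_sup fy; rewrite /A /= e1 e2.
by apply: measurable_fun_ifT => //; exact: measurable_in.
Qed.

End measurable_limn.

Section energy_measurable.
Context {R : realType} {d : nat}.
Variables (s : R).
Local Notation E := 'rV[R]_d.
Local Notation C := (conf R d).

Lemma bounded_borel_cube p : bounded_borel (cube p : set E).
Proof.
split.
  rewrite (_ : cube p = \bigcap_(i in [set: 'I_d])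
      ((fun x : E => x ord0 i) @^-1` `[- (side (d := d) p / 2), side (d := d) p / 2])).
    apply: fin_bigcap_measurable => // i _.
    by rewrite -[X in measurable X]setTI; exact: (measurable_coord i).
  apply/seteqP; split=> t /=.
    by move=> + i _ => /(_ i); rewrite /= in_itv.
  by move=> + i => /(_ i I); rewrite /= in_itv.
apply: (@bounded_set_box _ _ _ (side (d := d) p / 2)) => x i /(_ i).
by rewrite ler_norml.
Qed.

Lemma measurable_riesz_sub d1 (T : measurableType d1) (f g : T -> E) :
  measurable_fun setT f -> measurable_fun setT g ->
  measurable_fun setT (fun t => riesz s (f t - g t)).
Proof.
move=> mf mg.
have mc i : measurable_fun setT (fun t => (f t - g t) ord0 i).
  rewrite (_ : (fun _ => _) = fun t => f t ord0 i - g t ord0 i); last first.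
    by apply/funext => t; rewrite !mxE.
  apply: measurable_funB.
    by apply: (measurableT_comp (measurable_coord i)).
  by apply: (measurableT_comp (measurable_coord i)).
apply: measurable_fun_ifT.
- rewrite (_ : (fun _ => _) = fun t =>
     t \in \bigcap_(i in [set: 'I_d]) [set t | (f t - g t) ord0 i == 0]).
    apply: measurable_in; apply: fin_bigcap_measurable => // i _.
    by apply: measurable_boolset; apply: measurable_fun_eqr.
  apply/funext => t; apply/idP/idP.
    by move=> /eqP e; apply/mem_set => i _ /=; rewrite e mxE.
  move=> /set_mem h; apply/eqP/rowP => i; have /eqP := h i I.
  by rewrite /= !mxE.
- exact: measurable_cst.
- apply/measurable_EFinP; apply: (measurableT_comp (measurable_powR _)).
  apply: (measurableT_comp (continuous_measurable_fun (@sqrt_continuous R))).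
  by apply: measurable_sum => i; exact: measurable_funX.
Qed.

Lemma measurable_riesz d1 (T : measurableType d1) (f : T -> E) :
  measurable_fun setT f -> measurable_fun setT (fun t => riesz s (f t)).
Proof.
move=> mf; rewrite (_ : (fun _ => _) = fun t => riesz s (f t - 0)).
  by apply: measurable_riesz_sub => //; exact: measurable_cst.
by apply/funext => t; rewrite subr0.
Qed.

(** A sum over the points in a cube is a sum along their measurable enumeration,
    whose length is itself a measurable function. *)
Lemma measurable_diff_potential :
  measurable_fun setT (fun p : E * C => diff_potential s p.1 p.2).
Proof.
rewrite /diff_potential.
apply: (measurableT_comp (f := @fine R)) => //.
apply: measurable_fun_limn => p.
have bc := bounded_borel_cube p.
under eq_fun do rewrite (fsbig_listing bc).
pose F n (z : E * C) : \bar R := (\sum_(y <- listing (cube p) n z.2)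
  (riesz s (y - z.1)%R - riesz s y))%E.
apply: (@measurable_fun_natcase _ _ _ _ (fun z : E * C => npoints (cube p) z.2) F).
  by apply: measurableT_comp => //; exact: measurable_npoints.
move=> n; rewrite /F.
under eq_fun do rewrite big_tuple.
apply: emeasurable_sum => i.
have ml : measurable_fun setT (fun z : E * C => tnth (listing (cube p) n z.2) i).
  have mL := measurableT_comp (@measurable_listing _ _ _ bc n)
    (@measurable_snd _ _ E C).
  exact: (measurableT_comp (measurable_tnth i) mL).
apply: emeasurable_funB; last exact: measurable_riesz.
exact: measurable_riesz_sub.
Qed.

Lemma measurable_h_star (Psi : C -> R) : measurable_fun setT Psi ->
  measurable_fun setT (fun p : E * C => h_star s Psi p.1 p.2).
Proof.
move=> mPsi; apply: measurable_funD; first exact: measurable_diff_potential.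
exact: measurableT_comp.
Qed.

End energy_measurable.

(** * Reordering words, and adding the points of a word to a configuration *)

Section swaps.
Variable T : eqType.
Implicit Types (s t : seq T) (w : seq nat).

Fixpoint swap_at (i : nat) (s : seq T) : seq T :=
  match i, s with
  | 0, x :: y :: r => y :: x :: r
  | j.+1, x :: r => x :: swap_at j r
  | _, _ => s
  end.

(** Permutations are encoded as words of adjacent transpositions, read from the
    right.  The same countable set of words serves tuples of all lengths. *)
Definition swaps (w : seq nat) (s : seq T) : seq T := foldr swap_at s w.

Lemma perm_swap_at i s : perm_eq (swap_at i s) s.
Proof.
elim: i s => [|i IH] [|x s] //=; last by rewrite perm_cons.
by case: s => // y r; exact: (permEl (perm_catCA [:: y] [:: x] r)).
Qed.

Lemma swaps_cons w x s : swaps (map succn w) (x :: s) = x :: swaps w s.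
Proof. by elim: w => //= i w ->. Qed.

Lemma swaps_cat w1 w2 s : swaps (w1 ++ w2) s = swaps w1 (swaps w2 s).
Proof. exact: foldr_cat. Qed.

Lemma perm_eq_swaps s t : perm_eq s t -> exists w, s = swaps w t.
Proof.
have front x t1 t2 : exists w, swaps w (t1 ++ x :: t2) = x :: (t1 ++ t2).
  elim: t1 => [|y t1 [w IH]]; first by exists [::].
  by exists (0%N :: map succn w); rewrite /= swaps_cons IH.
elim: s t => [|x s IH] t.
  by rewrite perm_sym => /perm_nilP ->; exists [::].
move=> st; have : x \in t by rewrite -(perm_mem st) mem_head.
move=> /path.splitPr xt; case: xt st => t1 t2.
have [w1 w1E] := front x t1 t2.
rewrite perm_sym perm_catC /= perm_cons perm_catC perm_sym => /IH[w2 w2E].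
by exists (map succn w2 ++ w1); rewrite swaps_cat w1E swaps_cons w2E.
Qed.

End swaps.

Section measurable_swaps.
Context d (T : measurableType d).

Lemma measurable_thead n : measurable_fun setT (fun t : n.+1.-tuple T => thead t).
Proof. exact: (measurable_tnth ord0). Qed.

Lemma measurable_swap_at i n : {f : n.-tuple T -> n.-tuple T |
  measurable_fun setT f & forall t, tval (f t) = swap_at i t}.
Proof.
elim: i n => [|i IH] [|n].
- by exists id => // t; rewrite [t]tuple0.
- case: n => [|n].
    by exists id => // t; case/tupleP: t => x t; rewrite [t]tuple0.
  pose b1 (t : n.+2.-tuple T) : n.+1.-tuple T := [tuple of behead t].
  pose b2 (t : n.+1.-tuple T) : n.-tuple T := [tuple of behead t].
  exists (fun t => [tuple of thead (b1 t) :: [tuple of thead t :: b2 (b1 t)]]).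
    have mb := @measurable_behead _ T n.+1.
    apply: measurable_cons.
      exact: (measurableT_comp (@measurable_thead n) mb).
    apply: measurable_cons; first exact: measurable_thead.
    exact: (measurableT_comp (@measurable_behead _ T n) mb).
  by move=> t; case/tupleP: t => x t; case/tupleP: t => y t.
- by exists id => // t; rewrite [t]tuple0.
- have [f mf fE] := IH n.
  pose b (t : n.+1.-tuple T) : n.-tuple T := [tuple of behead t].
  exists (fun t => [tuple of thead t :: f (b t)]).
    apply: measurable_cons; first exact: measurable_thead.
    exact: (measurableT_comp mf (@measurable_behead _ T n)).
  by move=> t; case/tupleP: t => x t /=; rewrite fE /= theadE.
Qed.

End measurable_swaps.

Section power_support.
Context d (T : measurableType d) (R : realType).
Variable mu : {sigma_finite_measure set T -> \bar R}.
Variable D : set T.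
Hypotheses (mD : measurable D) (muD : mu (~` D) = 0%E).
Local Open Scope ereal_scope.

Definition tuples_in n : set (n.-tuple T) := [set t | {in tval t, forall x, D x}].

Lemma tuples_in_cons n x (t : n.-tuple T) :
  tuples_in [tuple of x :: t] <-> D x /\ tuples_in t.
Proof.
split=> [h|[Dx h] y]; last by rewrite inE => /predU1P[->//|/h].
by split=> [|y yt]; apply: h; rewrite inE ?eqxx// yt orbT.
Qed.

Lemma measurable_tuples_in n : measurable (@tuples_in n).
Proof.
rewrite (_ : @tuples_in n = \bigcap_(i in [set: 'I_n])
    ((fun t : n.-tuple T => tnth t i) @^-1` D)).
  apply: fin_bigcap_measurable => // i _.
  by rewrite -[X in measurable X]setTI; exact: (measurable_tnth i).
apply/seteqP; split=> t /=; first by move=> h i _; apply: h; exact: mem_tnth.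
by move=> h x /tnthP[i ->]; exact: (h i).
Qed.

Lemma power_supported n : power mu n (~` @tuples_in n) = 0.
Proof.
elim: n => [|n IH].
  rewrite (_ : ~` _ = set0) ?measure0//.
  by apply/seteqP; split=> // t; apply; move=> x; rewrite [t]tuple0.
rewrite powerSE /pushforward.
have mC := measurableC (@measurable_tuples_in n).
have e1 : (mu \x power mu n) (~` D `*` setT) <= 0.
  by rewrite product_measure1E//; [rewrite [X in X * _]muD mul0e|
    exact: measurableC].
have e2 : (mu \x power mu n) (setT `*` ~` @tuples_in n) <= 0.
  by rewrite product_measure1E// [X in _ * X]IH mule0.
apply/eqP; rewrite -measure_le0.
apply: (@le_trans _ _ ((mu \x power mu n)
    ((~` D `*` setT) `|` (setT `*` ~` @tuples_in n)))).
  apply: le_measure; rewrite ?inE.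
  - have mc : measurable_fun setT
      (fun p : T * n.-tuple T => [tuple of p.1 :: p.2]) by exact: measurable_cons.
    rewrite -[X in measurable X]setTI; apply: mc => //.
    by apply: measurableC; exact: measurable_tuples_in.
  - by apply: measurableU; apply: measurableX => //; exact: measurableC.
  - move=> [x t] /= h; have [Dx|Dx] := pselect (D x); last by left.
    by right; split => // ht; apply: h; apply/tuples_in_cons.
have mA : measurable (~` D `*` [set: n.-tuple T]).
  by apply: measurableX => //; exact: measurableC.
have mB : measurable ([set: T] `*` ~` @tuples_in n) by exact: measurableX.
apply: (le_trans (measureU2 _ mA mB)).
rewrite -[leRHS]adde0; apply: leeD; [exact: e1|exact: e2].
Qed.

End power_support.

Section additions.
Context {R : realType} {d : nat}.
Local Notation E := 'rV[R]_d.
Local Notation C := (conf R d).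

Definition addl (t : seq E) (g : C) : C := conf_union g (conf_seq t).

Lemma addl0 g : addl [::] g = g.
Proof.
by apply: conf_ext; rewrite /= set_nil setU0.
Qed.

Lemma addl_cons x t g : addl (x :: t) g = conf_add (addl t g) x.
Proof.
apply: conf_ext; rewrite /=; apply/seteqP; split=> y /=.
  move=> [gy|]; first by left; left.
  by rewrite inE => /predU1P[->|ty]; [right; rewrite inE|left; right].
by move=> [[gy|ty]|]; [left|right; rewrite inE ty orbT|
  rewrite inE => /eqP ->; right; exact: mem_head].
Qed.

Lemma eq_addl s t g : s =i t -> addl s g = addl t g.
Proof.
move=> st; apply: conf_ext => /=; congr (_ `|` _).
by apply/seteqP; split=> y /=; rewrite st.
Qed.

Lemma conf_union_seq t g : conf_union (conf_seq t) g = addl t g.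
Proof. by apply: conf_ext; rewrite /= setUC. Qed.

Lemma addl_empty t : addl t (conf_seq [::]) = conf_seq t.
Proof. by apply: conf_ext; rewrite /= set_nil set0U. Qed.

Lemma measurable_addl n :
  measurable_fun setT (fun p : n.-tuple E * C => addl p.1 p.2).
Proof.
elim: n => [|n IH].
  rewrite (_ : (fun _ => _) = snd); first exact: measurable_snd.
  by apply/funext => -[t g]; rewrite [t]tuple0 /= addl0.
have mt : measurable_fun setT (fun p : n.+1.-tuple E * C => thead p.1).
  exact: (measurableT_comp (@measurable_thead _ E n) measurable_fst).
have mb : measurable_fun setT
    (fun p : n.+1.-tuple E * C => ([tuple of behead p.1] : n.-tuple E, p.2)).
  apply: measurable_fun_pair => //.
  exact: (measurableT_comp (@measurable_behead _ E n) measurable_fst).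
have := measurableT_comp measurable_conf_add
  (measurable_fun_pair mt (measurableT_comp IH mb)).
congr (measurable_fun _ _); apply/funext => -[t g] /=.
by case/tupleP: t => x t; rewrite theadE -addl_cons.
Qed.

Lemma measurable_conf_tuple n :
  measurable_fun setT (fun t : n.-tuple E => conf_tuple t).
Proof.
have := measurable_fun_pair1 (conf_seq [::]) (@measurable_addl n).
by congr (measurable_fun _ _); apply/funext => t /=; exact: addl_empty.
Qed.

Variable h : E -> C -> R.

(** Energy of adding the entries of [t] to [g], the last entry first.  This
    order makes the head of a tuple the last point to be added, in accordance
    with the recursion for integrals over tuples. *)
Fixpoint rev_energy (t : seq E) (g : C) : R :=
  if t is x :: r then rev_energy r g + h x (addl r g) else 0.

Lemma energy_seq_rcons t x g :
  energy_seq h (rcons t x) g = energy_seq h t g + h x (addl t g).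
Proof.
elim: t g => [|y t IH] g /=; first by rewrite addl0 add0r addr0.
rewrite IH addrA; congr (_ + h x _).
apply: conf_ext; rewrite /=; apply/seteqP; split=> z /=.
  move=> [[gz|]|tz]; first by left.
    by rewrite inE => /eqP ->; right; exact: mem_head.
  by right; rewrite inE tz orbT.
move=> [gz|]; first by left; left.
by rewrite inE => /predU1P[->|tz]; [left; right; rewrite inE|right].
Qed.

Lemma energy_seq_rev t g : energy_seq h (rev t) g = rev_energy t g.
Proof.
elim: t => //= x t IH; rewrite rev_cons energy_seq_rcons IH.
by congr (_ + h x _); apply: eq_addl => y; rewrite mem_rev.
Qed.

Hypothesis mh : measurable_fun setT (fun p : E * C => h p.1 p.2).

Lemma measurable_rev_energy n :
  measurable_fun setT (fun p : n.-tuple E * C => rev_energy p.1 p.2).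
Proof.
elim: n => [|n IH].
  rewrite (_ : (fun _ => _) = cst 0) //.
  by apply/funext => -[t g]; rewrite [t]tuple0.
have mt : measurable_fun setT (fun p : n.+1.-tuple E * C => thead p.1).
  exact: (measurableT_comp (@measurable_thead _ E n) measurable_fst).
have mb : measurable_fun setT
    (fun p : n.+1.-tuple E * C => ([tuple of behead p.1] : n.-tuple E, p.2)).
  apply: measurable_fun_pair => //.
  exact: (measurableT_comp (@measurable_behead _ E n) measurable_fst).
have m1 := measurableT_comp IH mb.
have m2 := measurableT_comp mh
  (measurable_fun_pair mt (measurableT_comp (@measurable_addl n) mb)).
have := measurable_funD m1 m2.
congr (measurable_fun _ _); apply/funext => -[t g] /=.
by case/tupleP: t => x t; rewrite theadE.
Qed.

End additions.

(** * The Poisson process in a bounded region *)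

Section restriction.
Context d (T : measurableType d) (R : realType).
Variables (m : {measure set T -> \bar R}) (D : set T) (mD : measurable D).
Local Open Scope ereal_scope.

Lemma ge0_integral_mrestr (f : T -> \bar R) :
  measurable_fun setT f -> (forall x, 0 <= f x) ->
  \int[mrestr m mD]_x f x = \int[m]_(x in D) f x.
Proof.
move=> mf f0.
rewrite (@ge0_negligible_integral _ _ _ (mrestr m mD) setT (~` D))//.
- rewrite setTD setCK; apply: eq_measure_integral => A mA AD.
  by rewrite /= /mrestr setIidl.
- exact: measurableC.
- by rewrite /= /mrestr setICl measure0.
Qed.

Lemma restriction_sigma_finite : m D < +oo ->
  {mu : {sigma_finite_measure set T -> \bar R} |
    mu = (fun A => m (A `&` D)) :> (_ -> _)}.
Proof.
move=> mDoo.
have sf : sigma_finite setT (mrestr m mD).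
  apply: fin_num_fun_sigma_finite; first by rewrite measure0.
  move=> A mA; rewrite ge0_fin_numE//; apply: le_lt_trans mDoo.
  by rewrite /mrestr; apply: le_measure; rewrite ?inE//; exact: measurableI.
have [mu muE] := sigma_finite_pack sf.
by exists mu; rewrite muE.
Qed.

End restriction.

Section poisson.
Context {R : realType} {d : nat}.
Local Notation E := 'rV[R]_d.
Local Notation C := (conf R d).
Variables (mu : {sigma_finite_measure set E -> \bar R}) (D : set E).
Hypotheses (bD : bounded_borel D).
Hypothesis muE : mu = (fun A => lebesgue_rV (A `&` D)) :> (_ -> _).
Local Open Scope ereal_scope.

Definition void_probability : R := expR (- fine (lebesgue_rV D)).

Lemma poisson_measure : {Pi : {measure set C -> \bar R} |
  Pi = poisson_process D :> (_ -> _) &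
  forall U : C -> \bar R, measurable_fun setT U -> (forall g, 0 <= U g) ->
  \int[Pi]_g U g = void_probability%:E *
    \sum_(0 <= n <oo) ((n`!%:R^-1)%:E * \int[power mu n]_t U (conf_tuple t))}.
Proof.
pose push n := sval (image_measureP (power mu n) (@measurable_conf_tuple R d n)).
have pushE n : push n = pushforward (power mu n) (@conf_tuple R d n) :> (_ -> _).
  exact: (svalP (image_measureP (power mu n) (@measurable_conf_tuple R d n))).
have f0 n : (0 <= n`!%:R^-1 :> R)%R by rewrite invr_ge0.
have l0 : (0 <= void_probability)%R by exact: expR_ge0.
pose q n : {measure set C -> \bar R} := mscale (NngNum (f0 n)) (push n).
pose qs : {measure set C -> \bar R} := mseries q 0.
pose Pi : {measure set C -> \bar R} := mscale (NngNum l0) qs.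
exists Pi.
  apply/funext => A; rewrite /poisson_process /Pi /= /mscale /=; congr (_ * _).
  rewrite /qs /= /mseries; apply: eq_eseriesr => n _.
  by rewrite /q /= /mscale /= pushE powerE muE.
move=> U mU U0.
rewrite (ge0_integral_mscale qs measurableT (NngNum l0) mU)//; congr (_ * _).
rewrite (ge0_integral_measure_series q measurableT)//.
apply: eq_eseriesr => n _.
rewrite (ge0_integral_mscale (push n) measurableT (NngNum (f0 n)) mU)//.
congr (_ * _); rewrite pushE ge0_integral_pushforward//.
exact: measurable_conf_tuple.
Qed.

Lemma npoints_conf_seq (t : seq E) : {in t, forall x, D x} ->
  npoints D (conf_seq t) = size (undup t).
Proof.
move=> tD; rewrite -card_fseq /npoints; congr (#|` _|).
apply/fsetP => x; rewrite in_fset_set; last exact: finite_conf bD.2.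
rewrite !inE /=; apply/idP/idP; first by move=> /set_mem[].
by move=> xt; apply/mem_set; split => //; exact: tD.
Qed.

Lemma uniq_conf_seq (t : seq E) : {in t, forall x, D x} ->
  npoints D (conf_seq t) = size t -> uniq t.
Proof.
move=> tD; rewrite (npoints_conf_seq tD) => e.
by apply: contraT; rewrite -ltn_size_undup e ltnn.
Qed.

Lemma measurable_subset_D : measurable [set g : C | points g `<=` D].
Proof.
rewrite (_ : [set _ | _] = \bigcap_(c in setT)
    [set g : C | npoints (~` D `&` cell c 0) g = 0%N]).
  rewrite -[X in measurable X]setCK setC_bigcap; apply: measurableC.
  apply: countable_bigcupT_measurable => // c; apply: measurableC.
  have bc : bounded_borel (~` D `&` cell c 0).
    apply: bounded_borelI; first by apply: measurableC; exact: bD.1.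
    exact: bounded_borel_cell.
  by have := measurable_npoints bc measurableT (Y := [set 0%N]); rewrite setTI; exact.
apply/seteqP; split=> g /=.
  move=> gD c _ /=; apply/npoints0.
    by apply: bounded_setS (bounded_borel_cell c 0).2; exact: subIsetr.
  by apply/seteqP; split=> // x [gx [nDx _]]; apply: nDx; exact: gD.
move=> h x gx; have [c cx] := mem_cell x 0.
apply: contrapT => nDx; have := h c I => /= /npoints0.
have bc : bounded_set (~` D `&` cell c 0).
  by apply: bounded_setS (bounded_borel_cell c 0).2; exact: subIsetr.
by move=> /(_ bc) e; rewrite -[False]/(set0 x) -e.
Qed.

(** For integrands [f] that fail to be measurable.  The predicate [T] describes almost
    all tuples and is stable under permutation; on it, [phi] does not depend on
    the order.  Composing [phi] with the measurable enumeration yields a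
    measurable function that agrees with [f] off a null set. *)
Lemma poisson_integral (f : C -> \bar R) (phi : seq E -> \bar R)
    (T : seq E -> Prop) :
  (forall g, 0 <= f g) -> (forall t, 0 <= phi t) ->
  (forall n, measurable_fun setT (fun t : n.-tuple E => phi t)) ->
  (forall n, measurable [set t : n.-tuple E | T t]) ->
  (forall n, power mu n [set t : n.-tuple E | ~ T t] = 0) ->
  (forall t, T t -> [/\ {in t, forall x, D x},
     npoints D (conf_seq t) = size t & f (conf_seq t) = phi t]) ->
  (forall s t, perm_eq s t -> T t -> T s /\ phi s = phi t) ->
  \int[poisson_process D]_g f g = void_probability%:E *
    \sum_(0 <= n <oo) ((n`!%:R^-1)%:E * \int[power mu n]_t phi t).
Proof.
move=> f0 phi0 mphi mT T0 TE Tperm.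
have [Pi PiE PiI] := poisson_measure.
pose L (g : C) : seq E := listing D (npoints D g) g.
pose U (g : C) : \bar R := phi (L g).
have mL n : measurable_fun setT (@listing R d D n) := @measurable_listing _ _ _ bD n.
have mN := measurable_npoints bD.
have mU : measurable_fun setT U.
  apply: (@measurable_fun_natcase _ _ _ _ (npoints D)
    (fun n (g : C) => phi (listing D n g))) => // n.
  exact: (measurableT_comp (mphi n) (mL n)).
have U0 g : 0 <= U g by exact: phi0.
pose G := [set g : C | points g `<=` D /\ T (L g)].
have mG : measurable G.
  suff mTL : measurable [set g : C | T (L g)].
    exact: (measurableI _ _ measurable_subset_D mTL).
  rewrite (_ : [set g : C | T (L g)] = \bigcup_n
     ([set g : C | npoints D g = n] `&` listing D n @^-1` [set t : n.-tuple E | T t])).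
    apply: bigcupT_measurable => n; apply: measurableI.
      by have := mN measurableT [set n]; rewrite setTI; exact.
    by rewrite -[X in measurable X]setTI; exact: (mL n measurableT _ (mT n)).
  apply/seteqP; split=> g /=; first by exists (npoints D g).
  by move=> [n _ [/= <-]].
have TL n (t : n.-tuple E) : T t -> perm_eq (L (conf_tuple t)) t.
  move=> Tt; have [tD tn _] := TE _ Tt.
  have [u lE] := listingP bD (erefl (npoints D (conf_tuple t))).
  apply: uniq_perm => //; first exact: uniq_conf_seq.
  move=> x; apply/idP/idP => xl.
    have : [set` (listing D (npoints D (conf_tuple t)) (conf_tuple t) : seq E)] x by [].
    by rewrite lE => -[].
  suff : [set` (listing D (npoints D (conf_tuple t)) (conf_tuple t) : seq E)] x by [].
  by rewrite lE; split => //; exact: tD.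
have TG n (t : n.-tuple E) : T t -> G (conf_tuple t).
  move=> Tt; have [tD _ _] := TE _ Tt; split; first by move=> x /= /tD.
  by have [] := Tperm _ _ (TL _ _ Tt) Tt.
have PiG : Pi (~` G) = 0.
  rewrite PiE /poisson_process eseries0 ?mule0// => n _ _.
  rewrite /pushforward -muE -powerE.
  rewrite (_ : power mu n _ = 0) ?mule0//.
  apply: (subset_measure0 _ (measurableC (mT n)) _ (T0 n)).
    rewrite -[X in measurable X]setTI; apply: measurable_conf_tuple => //.
    exact: measurableC.
  by move=> t /= nG Tt; apply: nG; exact: TG.
rewrite -PiE (ge0_integral_off_null (measurableC mG) PiG f0 U0).
  rewrite (PiI U mU U0); congr (_ * _); apply: eq_eseriesr => n _.
  congr (_ * _); apply: (ge0_integral_off_null (measurableC (mT n)) (T0 n)).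
  - by move=> t; exact: U0.
  - by move=> t; exact: phi0.
  - move=> t /contrapT Tt; rewrite /U.
    by have [] := Tperm _ _ (TL _ _ Tt) Tt.
move=> g /contrapT[gD TLg]; have [_ _ e] := TE _ TLg.
rewrite /U -e; congr f; apply: conf_ext => /=.
have [_ lE] := listingP bD (erefl (npoints D g)).
by rewrite lE; apply/seteqP; split=> x //= gx; [split => //; exact: gD|case: gx].
Qed.

End poisson.

(** * The n-point formula *)

Section gnz.
Context {R : realType} {d : nat}.
Local Notation E := 'rV[R]_d.
Local Notation C := (conf R d).
Variables (mu : {sigma_finite_measure set E -> \bar R}) (D : set E).
Hypothesis bD : bounded_borel D.
Hypothesis muE : mu = (fun A => lebesgue_rV (A `&` D)) :> (_ -> _).

Let muD : mu (~` D) = 0%E.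
Proof. by rewrite muE setICl; have [m <-] := @lebesgue_rVP R d; rewrite measure0. Qed.

Let mufin : (mu setT < +oo)%E.
Proof. by rewrite muE setTI; exact: lebesgue_rV_fin. Qed.

Variables (P : probability C R) (beta : R) (h : E -> C -> R).
Hypothesis mh : measurable_fun setT (fun p : E * C => h p.1 p.2).

(** The density of the Campbell equation, and its product when the entries of a
    word are inserted one after the other. *)
Definition point_weight (x : E) (g : C) : R := expR (- (beta * h x g)).
Definition weight (t : seq E) (g : C) : R := expR (- (beta * rev_energy h t g)).

Hypothesis gnz : forall F : E * C -> \bar R, measurable_fun setT F ->
  (forall z, (0 <= F z)%E) ->
  (\int[P]_g \sum_(x \in points g `&` D) F (x, conf_del g x) =
   \int[mu]_x \int[P]_g (F (x, g) * (point_weight x g)%:E))%E.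

Local Open Scope ereal_scope.

Definition npoints_indic (n : nat) (g : C) : \bar R := ((npoints D g == n)%:R)%:E.

Lemma npoints_indic_ge0 n g : 0 <= npoints_indic n g.
Proof. by rewrite lee_fin. Qed.

Lemma measurable_npointsD : measurable_fun setT (npoints D : C -> nat).
Proof. exact: measurable_npoints. Qed.

Lemma measurable_npoints_indic n : measurable_fun setT (npoints_indic n).
Proof.
apply/measurable_EFinP.
rewrite (_ : (fun _ => _) = (fun k : nat => (k == n)%:R) \o npoints D)//.
exact: measurableT_comp measurable_npointsD.
Qed.

Lemma measurable_point_weight :
  measurable_fun setT (fun p : E * C => point_weight p.1 p.2).
Proof.
apply: (measurableT_comp (@measurable_expR R)).
by apply: measurable_funN; apply: measurable_funM => //; exact: measurable_cst.
Qed.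

Lemma measurable_weight n :
  measurable_fun setT (fun p : n.-tuple E * C => weight p.1 p.2).
Proof.
apply: (measurableT_comp (@measurable_expR R)).
apply: measurable_funN; apply: measurable_funM; first exact: measurable_cst.
exact: measurable_rev_energy.
Qed.

Lemma weight_cons x t g : weight (x :: t) g =
  (weight t g * point_weight x (addl t g))%R.
Proof. by rewrite /weight /= mulrDr opprD expRD. Qed.

Definition jointly_measurable n (F : seq E -> C -> \bar R) :=
  measurable_fun setT (fun p : n.-tuple E * C => F p.1 p.2).

Lemma measurable_cons_pair n :
  measurable_fun setT (fun p : (E * n.-tuple E) * C =>
    ([tuple of p.1.1 :: p.1.2] : n.+1.-tuple E, p.2)).
Proof.
apply: measurable_fun_pair => //.
have mc : measurable_fun setT
  (fun p : E * n.-tuple E => [tuple of p.1 :: p.2]) by exact: measurable_cons.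
exact: (measurableT_comp mc measurable_fst).
Qed.

Definition point_integral n (F : seq E -> C -> \bar R) :=
  \int[power mu n]_t \int[P]_g F t g.

Lemma measurable_point_integrand n F : jointly_measurable n F ->
  (forall t g, 0 <= F t g) ->
  measurable_fun setT (fun t : n.-tuple E => \int[P]_g F t g).
Proof.
move=> mF F0.
exact: (@measurable_fun_fubini_tonelli_F _ _ _ _ _ P
  (fun p : n.-tuple E * C => F p.1 p.2)).
Qed.

Lemma point_integral0 F : jointly_measurable 0 F -> (forall t g, 0 <= F t g) ->
  point_integral 0 F = \int[P]_g F [::] g.
Proof.
move=> mF F0; rewrite /point_integral ge0_integral_power0//.
  exact: measurable_point_integrand.
by move=> t; apply: integral_ge0 => g _.
Qed.

Lemma point_integralS n F : jointly_measurable n.+1 F ->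
  (forall t g, 0 <= F t g) ->
  point_integral n.+1 F = \int[mu]_x point_integral n (fun t => F (x :: t)).
Proof.
move=> mF F0; rewrite /point_integral ge0_integral_powerS//.
  exact: measurable_point_integrand.
by move=> t; apply: integral_ge0 => g _.
Qed.

Lemma measurable_point_integral n F : jointly_measurable n.+1 F ->
  (forall t g, 0 <= F t g) ->
  measurable_fun setT (fun x => point_integral n (fun t => F (x :: t))).
Proof.
move=> mF F0.
have mc : measurable_fun setT
  (fun p : E * n.-tuple E => [tuple of p.1 :: p.2]) by exact: measurable_cons.
have m1 := measurableT_comp (measurable_point_integrand mF F0) mc.
apply: (@measurable_fun_fubini_tonelli_F _ _ _ _ _ (power mu n)
  (fun z : E * n.-tuple E => \int[P]_g F (z.1 :: z.2) g)) => //.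
by move=> t; apply: integral_ge0 => g _.
Qed.

Lemma point_integral_ge0 n F : (forall t g, 0 <= F t g) ->
  0 <= point_integral n F.
Proof. by move=> F0; apply: integral_ge0 => t _; exact: integral_ge0. Qed.

Definition insertion (G : C -> \bar R) (t : seq E) (g : C) : \bar R :=
  npoints_indic 0 g * ((weight t g)%:E * G (addl t g)).

Lemma insertion_ge0 G t g : (forall g, 0 <= G g) -> 0 <= insertion G t g.
Proof.
move=> G0; rewrite /insertion mule_ge0 ?npoints_indic_ge0// mule_ge0//.
by rewrite lee_fin expR_ge0.
Qed.

Lemma jointly_measurable_insertion n G : measurable_fun setT G ->
  jointly_measurable n (insertion G).
Proof.
move=> mG; apply: emeasurable_funM.
  exact: (measurableT_comp (measurable_npoints_indic 0) measurable_snd).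
apply: emeasurable_funM; first by apply/measurable_EFinP; exact: measurable_weight.
exact: (measurableT_comp mG (@measurable_addl _ _ n)).
Qed.

Lemma sum_points_cst (c : \bar R) (g : C) : 0 <= c ->
  \sum_(x \in points g `&` D) c = (npoints D g)%:R%:E * c.
Proof.
move=> c0; rewrite (fsbig_listing bD) big_tuple sumr_const card_ord.
elim: (npoints D g) => [|n IH]; first by rewrite mulr0n mul0e.
by rewrite mulrS IH -{1}[c]mul1e -ge0_muleDl// -EFinD nat1r.
Qed.

(** By induction on [n].  The Campbell equation is applied to
    [1{N_D(g) = n} G(g + x)]: if [g] has [n + 1] points in [D], then each of
    them, once removed, leaves [n] points and contributes [G g], which gives the
    factor [n + 1] of the factorial.  On the other side, the induction
    hypothesis adds [n] points to [g] and the point [x] comes last. *)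
Lemma n_point_formula n G : measurable_fun setT G -> (forall g, 0 <= G g) ->
  \int[P]_g (npoints_indic n g * G g) = (n`!%:R^-1)%:E * point_integral n (insertion G).
Proof.
elim: n G => [|n IH] G mG G0.
  rewrite point_integral0; [|exact: jointly_measurable_insertion|by move=> t g; exact: insertion_ge0].
  rewrite fact0 invr1 mul1e; apply: eq_integral => g _.
  by rewrite /insertion addl0 /weight/= mulr0 oppr0 expR0 mul1e.
pose F (z : E * C) := npoints_indic n z.2 * G (conf_add z.2 z.1).
have mF : measurable_fun setT F.
  apply: emeasurable_funM.
    exact: (measurableT_comp (measurable_npoints_indic n) measurable_snd).
  exact: (measurableT_comp mG measurable_conf_add).
have F0 z : 0 <= F z by rewrite mule_ge0// npoints_indic_ge0.
have := gnz mF F0.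
under eq_integral => g _.
  rewrite (_ : \sum_(x \in _) _ = n.+1%:R%:E * (npoints_indic n.+1 g * G g)).
    over.
  rewrite (@eq_fsbigr _ _ _ _ _ (fun=> npoints_indic n.+1 g * G g)).
    rewrite sum_points_cst ?mule_ge0 ?npoints_indic_ge0// /npoints_indic.
    by case: eqP => [->|_]; rewrite ?mul0e ?mule0.
  move=> x /set_mem[gx Dx]; rewrite /F/= conf_addK// /npoints_indic.
  rewrite npoints_del; last exact: bD.2.
  rewrite !mem_set//=; congr ((_ %:R)%:E * _).
  have : (0 < npoints D g)%N.
    by apply/npoints_gt0; [exact: bD.2|exists x].
  by case: (npoints D g) => // k _; rewrite subn1.
rewrite ge0_integralZl//; last 2 first.
- by apply: emeasurable_funM => //; exact: measurable_npoints_indic.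
- by move=> g _; rewrite mule_ge0// npoints_indic_ge0.
under [RHS]eq_integral => x _.
  under eq_integral => g _ do rewrite /F/= -muleA.
  rewrite (IH (fun g => G (conf_add g x) * (point_weight x g)%:E)); last 2 first.
  - apply: emeasurable_funM.
      have mx : measurable_fun setT (fun g : C => (x, g)).
        by apply: measurable_fun_pair => //; exact: measurable_cst.
      exact: (measurableT_comp mG (measurableT_comp measurable_conf_add mx)).
    by apply/measurable_EFinP; exact: (measurable_fun_pair2 x measurable_point_weight).
  - by move=> g; rewrite mule_ge0// lee_fin expR_ge0.
  rewrite (_ : point_integral n _ = point_integral n (fun t => insertion G (x :: t))); last first.
    apply: eq_integral => t _; apply: eq_integral => g _.
    rewrite /insertion weight_cons addl_cons EFinM -!muleA; congr (_ * (_ * _)).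
    by rewrite muleC.
  over.
rewrite ge0_integralZl//; last 2 first.
- apply: measurable_point_integral; first exact: jointly_measurable_insertion.
  by move=> t g; exact: insertion_ge0.
- by move=> x _; apply: point_integral_ge0 => t g; exact: insertion_ge0.
rewrite -point_integralS; [|exact: jointly_measurable_insertion|by move=> t g; exact: insertion_ge0].
move=> e; rewrite factS natrM invfM EFinM -muleA -e muleA -EFinM.
by rewrite mulVf ?mul1e// pnatr_eq0.
Qed.

(** * The unnormalised specification *)

Definition gibbs_term (G : C -> \bar R) n (g : C) : \bar R :=
  \int[power mu n]_t ((weight t g)%:E * G (addl t g)).

(** For almost every [g] outside [D], and up to the factor [exp (- lambda D)],
    the integral of [eta |-> exp (- beta H(eta, g)) G(g + eta)] under the
    Poisson process in [D]. *)
Definition gibbs_sum (G : C -> \bar R) (g : C) : \bar R :=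
  \sum_(0 <= n <oo) ((n`!%:R^-1)%:E * gibbs_term G n g).

Lemma fact_inv_ge0 n : (0 <= n`!%:R^-1 :> R)%R.
Proof. by rewrite invr_ge0. Qed.

Lemma gibbs_term_ge0 G n g : (forall g, 0 <= G g) -> 0 <= gibbs_term G n g.
Proof.
move=> G0; apply: integral_ge0 => t _.
by rewrite mule_ge0// lee_fin expR_ge0.
Qed.

Lemma scaled_gibbs_term_ge0 G n g : (forall g, 0 <= G g) ->
  0 <= (n`!%:R^-1)%:E * gibbs_term G n g.
Proof. by move=> G0; rewrite mule_ge0 ?lee_fin ?fact_inv_ge0// gibbs_term_ge0. Qed.

Lemma gibbs_sum_ge0 G g : (forall g, 0 <= G g) -> 0 <= gibbs_sum G g.
Proof.
by move=> G0; apply: nneseries_ge0 => n _ _; exact: scaled_gibbs_term_ge0.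
Qed.

Lemma measurable_gibbs_integrand G n : measurable_fun setT G ->
  measurable_fun setT
    (fun p : n.-tuple E * C => (weight p.1 p.2)%:E * G (addl p.1 p.2)).
Proof.
move=> mG; apply: emeasurable_funM.
  by apply/measurable_EFinP; exact: measurable_weight.
exact: (measurableT_comp mG (@measurable_addl _ _ n)).
Qed.

Lemma measurable_gibbs_term G n : measurable_fun setT G -> (forall g, 0 <= G g) ->
  measurable_fun setT (gibbs_term G n).
Proof.
move=> mG G0.
apply: (@measurable_fun_fubini_tonelli_G _ _ _ _ _ (power mu n)
  (fun p : n.-tuple E * C => (weight p.1 p.2)%:E * G (addl p.1 p.2))).
  exact: measurable_gibbs_integrand.
by move=> p; rewrite mule_ge0// lee_fin expR_ge0.
Qed.

Lemma measurable_gibbs_sum G : measurable_fun setT G -> (forall g, 0 <= G g) ->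
  measurable_fun setT (gibbs_sum G).
Proof.
move=> mG G0; apply: ge0_emeasurable_sum.
  by move=> n g _ _; exact: scaled_gibbs_term_ge0.
move=> n _; apply: emeasurable_funM; first exact: measurable_cst.
exact: measurable_gibbs_term.
Qed.

Lemma point_integral_insertion n G : measurable_fun setT G ->
  (forall g, 0 <= G g) ->
  point_integral n (insertion G) = \int[P]_g (npoints_indic 0 g * gibbs_term G n g).
Proof.
move=> mG G0; rewrite /point_integral.
have := @fubini_tonelli _ _ _ _ _ (power mu n) P
  (fun p : n.-tuple E * C => insertion G p.1 p.2) (@jointly_measurable_insertion n G mG).
move=> ->; last by move=> p; exact: insertion_ge0.
apply: eq_integral => g _; rewrite /insertion/= ge0_integralZl ?npoints_indic_ge0//.
  have mg : measurable_fun setT (fun t : n.-tuple E => (t, g)).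
    by apply: measurable_fun_pair => //; exact: measurable_cst.
  exact: (measurableT_comp (@measurable_gibbs_integrand G n mG) mg).
by move=> t _; rewrite mule_ge0// lee_fin expR_ge0.
Qed.

Lemma sum_npoints_indic (c : \bar R) g : 0 <= c ->
  \sum_(0 <= n <oo) (npoints_indic n g * c) = c.
Proof.
move=> c0; apply: cvg_lim => //; apply: cvg_near_cst.
near=> n; rewrite big_mkord.
have Nn : (npoints D g < n)%N by near: n; exact: nbhs_infty_gt.
rewrite (bigD1 (Ordinal Nn))//= big1 ?adde0.
  by rewrite /npoints_indic eqxx mul1e.
move=> i; rewrite -val_eqE/= => iN; rewrite /npoints_indic eq_sym (negbTE iN).
by rewrite mul0e.
Unshelve. all: by end_near. Qed.

Lemma integral_gibbs_sum G : measurable_fun setT G -> (forall g, 0 <= G g) ->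
  \int[P]_g G g = \int[P]_g (npoints_indic 0 g * gibbs_sum G g).
Proof.
move=> mG G0.
transitivity (\int[P]_g \sum_(0 <= n <oo) (npoints_indic n g * G g)).
  by apply: eq_integral => g _; rewrite sum_npoints_indic.
rewrite integral_nneseries//; last 2 first.
- by move=> n; apply: emeasurable_funM => //; exact: measurable_npoints_indic.
- by move=> n g _; rewrite mule_ge0// npoints_indic_ge0.
transitivity (\int[P]_g \sum_(0 <= n <oo)
    (npoints_indic 0 g * ((n`!%:R^-1)%:E * gibbs_term G n g))); last first.
  apply: eq_integral => g _; rewrite nneseriesZl// => n _.
  exact: scaled_gibbs_term_ge0.
rewrite integral_nneseries//; last 2 first.
- move=> n; apply: emeasurable_funM; first exact: measurable_npoints_indic.
  by apply: emeasurable_funM; [exact: measurable_cst|exact: measurable_gibbs_term].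
- by move=> n g _; rewrite mule_ge0 ?npoints_indic_ge0// scaled_gibbs_term_ge0.
apply: eq_eseriesr => n _; rewrite n_point_formula// point_integral_insertion//.
under [RHS]eq_integral do rewrite muleCA.
rewrite [RHS]ge0_integralZl//.
- apply: emeasurable_funM; first exact: measurable_npoints_indic.
  exact: measurable_gibbs_term.
- by move=> g _; rewrite mule_ge0 ?npoints_indic_ge0// gibbs_term_ge0.
Qed.

Definition outside (g : C) : C := restr g (~` D).
Definition partition_sum (g : C) : \bar R := gibbs_sum (cst 1) g.

Lemma outside_addl t g : {in t, forall x, D x} ->
  outside (addl t g) = outside g.
Proof.
move=> tD; apply: conf_ext; rewrite /=; apply/seteqP; split=> x /=.
  by move=> [[gx|/tD //] nDx].
by move=> [gx nDx]; split => //; left.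
Qed.

Lemma outside_id g : npoints D g = 0%N -> outside g = g.
Proof.
move=> /npoints0 -/(_ bD.2) g0; apply: conf_ext; rewrite /=.
apply/seteqP; split=> x /=; first by move=> [].
by move=> gx; split => // Dx; rewrite -[False]/(set0 x) -g0.
Qed.

Lemma measurable_outside : measurable_fun setT outside.
Proof. by apply: measurable_restr; apply: measurableC; exact: bD.1. Qed.

(** Inserting points of [D] does not change the configuration outside [D], so
    that [k] leaves the integral. *)
Lemma gibbs_term_outside k n g : measurable_fun setT k -> (forall g, 0 <= k g) ->
  npoints D g = 0%N ->
  gibbs_term (k \o outside) n g = k g * gibbs_term (cst 1) n g.
Proof.
move=> mk k0 g0.
have mg : measurable_fun setT (fun t : n.-tuple E => (t, g)).
  by apply: measurable_fun_pair => //; exact: measurable_cst.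
rewrite -ge0_integralZl//; last 2 first.
- exact: (measurableT_comp (@measurable_gibbs_integrand (cst 1) n
    (measurable_cst _)) mg).
- by move=> t _; rewrite mule_ge0// lee_fin expR_ge0.
apply: (@ge0_integral_off_null _ _ _ (power mu n) (~` @tuples_in _ _ D n)).
- by apply: measurableC; apply: measurable_tuples_in; exact: bD.1.
- by apply: power_supported => //; exact: bD.1.
- by move=> t; apply: mule_ge0; [rewrite lee_fin expR_ge0|exact: k0].
- by move=> t; apply: mule_ge0 => //; rewrite mule_ge0 ?lee_fin ?expR_ge0 ?ler01.
move=> t /contrapT tD; rewrite /= outside_addl// outside_id//.
by rewrite mule1 muleC.
Qed.

(** The configuration outside [D] has density [partition_sum] with respect to
    the law restricted to the event that [D] is empty. *)
Lemma integral_outside (k : C -> R) : measurable_fun setT k ->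
  (forall g, 0 <= k g)%R ->
  \int[P]_g (k (outside g))%:E =
  \int[P]_g (npoints_indic 0 g * ((k g)%:E * partition_sum g)).
Proof.
move=> mk k0; pose k' := EFin \o k.
have mk' : measurable_fun setT k' by apply/measurable_EFinP.
have k'0 g : 0 <= k' g by rewrite lee_fin.
rewrite (@integral_gibbs_sum (k' \o outside))//=; last first.
  exact: (measurableT_comp mk' measurable_outside).
apply: eq_integral => g _; rewrite /npoints_indic; case: eqP => [g0|_]; last first.
  by rewrite !mul0e.
congr (_ * _); rewrite /partition_sum /gibbs_sum.
rewrite -nneseriesZl; last by move=> n _; exact: scaled_gibbs_term_ge0.
by apply: eq_eseriesr => n _; rewrite gibbs_term_outside// muleCA.
Qed.

(** * Almost sure symmetry of the weight of a pair *)

Lemma integral_eq0_ae d1 (T : measurableType d1) (m : {measure set T -> \bar R})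
    (f : T -> \bar R) : measurable_fun setT f -> (forall x, 0 <= f x) ->
  \int[m]_x f x = 0 <-> {ae m, forall x, f x = 0}.
Proof.
move=> mf f0.
have <- : \int[m]_x `|f x| = \int[m]_x f x.
  by apply: eq_integral => x _; rewrite gee0_abs.
split=> [/(ae_eq_integral_abs _ measurableT mf).1|fae].
  by apply: filterS => x; exact.
apply/(ae_eq_integral_abs _ measurableT mf).
by apply: filterS fae => x fx _.
Qed.

Definition pair_weight (z : E * (E * C)) : R := weight [:: z.1; z.2.1] z.2.2.
Definition swapped_pair_weight (z : E * (E * C)) : R :=
  weight [:: z.2.1; z.1] z.2.2.

Lemma weight_pair x y g : weight [:: x; y] g =
  (point_weight x (conf_add g y) * point_weight y g)%R.
Proof.
rewrite !weight_cons addl_cons addl0 /weight/= mulr0 oppr0 expR0 mul1r.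
by rewrite mulrC.
Qed.

Lemma measurable_pair_weight : measurable_fun setT pair_weight.
Proof.
rewrite (_ : pair_weight = fun z => (point_weight z.1 (conf_add z.2.2 z.2.1) *
    point_weight z.2.1 z.2.2)%R); last by apply/funext => z; exact: weight_pair.
have m1 : measurable_fun setT
    (fun z : E * (E * C) => (z.1, conf_add z.2.2 z.2.1)).
  apply: measurable_fun_pair => //.
  exact: (measurableT_comp measurable_conf_add measurable_snd).
apply: measurable_funM; first exact: (measurableT_comp measurable_point_weight m1).
exact: (measurableT_comp measurable_point_weight measurable_snd).
Qed.

Definition swap2 (z : E * (E * C)) : E * (E * C) := (z.2.1, (z.1, z.2.2)).

Lemma measurable_swap2 : measurable_fun setT swap2.
Proof.
apply: measurable_fun_pair.
  exact: (measurableT_comp measurable_fst measurable_snd).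
apply: measurable_fun_pair => //.
exact: (measurableT_comp measurable_snd measurable_snd).
Qed.

(** Two applications of the Campbell equation; the second point to be removed is
    the first one to be added. *)
Lemma two_point_formula (F : E * (E * C) -> \bar R) :
  measurable_fun setT F -> (forall z, 0 <= F z) ->
  \int[P]_g (\sum_(x \in points g `&` D)
    \sum_(y \in points (conf_del g x) `&` D)
      F (x, (y, conf_del (conf_del g x) y))) =
  \int[mu]_x \int[mu]_y \int[P]_g (F (x, (y, g)) * (pair_weight (x, (y, g)))%:E).
Proof.
move=> mF F0.
pose F1 (z : E * C) :=
  \sum_(y \in points z.2 `&` D) F (z.1, (y, conf_del z.2 y)).
have F1E z : F1 z = \sum_(y <- listing D (npoints D z.2) z.2)
    F (z.1, (y, conf_del z.2 y)) by rewrite /F1 (fsbig_listing bD).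
have mF1 : measurable_fun setT F1.
  rewrite (_ : F1 = fun z => \sum_(y <- listing D (npoints D z.2) z.2)
    F (z.1, (y, conf_del z.2 y))); last by apply/funext => z; exact: F1E.
  pose G n (z : E * C) : \bar R := \sum_(y <- listing D n z.2)
    F (z.1, (y, conf_del z.2 y)).
  apply: (@measurable_fun_natcase _ _ _ _ (fun z : E * C => npoints D z.2) G).
    exact: (measurableT_comp measurable_npointsD measurable_snd).
  move=> n; rewrite /G; under eq_fun do rewrite big_tuple.
  apply: emeasurable_sum => i.
  have mL := measurableT_comp (@measurable_listing _ _ _ bD n)
    (@measurable_snd _ _ E C).
  have ml : measurable_fun setT (fun z : E * C => tnth (listing D n z.2) i).
    exact: (measurableT_comp (measurable_tnth i) mL).
  have md : measurable_fun setT (fun z : E * C =>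
      conf_del z.2 (tnth (listing D n z.2) i)).
    exact: (measurableT_comp measurable_conf_del
      (measurable_fun_pair ml measurable_snd)).
  exact: (measurableT_comp mF
    (measurable_fun_pair measurable_fst (measurable_fun_pair ml md))).
have F10 z : 0 <= F1 z by rewrite F1E; apply: sume_ge0.
rewrite (gnz mF1 F10); apply: eq_integral => x _.
pose F2 (z : E * C) := F (x, z) * (point_weight x (conf_add z.2 z.1))%:E.
have mx : measurable_fun setT (fun z : E * C => (x, z)).
  by apply: measurable_fun_pair => //; exact: measurable_cst.
have mF2 : measurable_fun setT F2.
  apply: emeasurable_funM; first exact: (measurableT_comp mF mx).
  apply/measurable_EFinP.
  have mx' : measurable_fun setT (fun z : E * C => (x, conf_add z.2 z.1)).
    by apply: measurable_fun_pair; [exact: measurable_cst|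
      exact: measurable_conf_add].
  exact: (measurableT_comp measurable_point_weight mx').
have F20 z : 0 <= F2 z by rewrite mule_ge0// lee_fin expR_ge0.
have := gnz mF2 F20; rewrite /F2/=.
under [X in _ = X -> _]eq_integral => y _.
  under eq_integral => g _ do rewrite -muleA -EFinM -weight_pair.
  over.
move=> <-; apply: eq_integral => g _.
rewrite F1E !(fsbig_listing bD) ge0_sume_distrl//=.
rewrite big_seq [RHS]big_seq; apply: eq_bigr => y yl.
have [_ lE] := listingP bD (erefl (npoints D g)).
have : [set` listing D (npoints D g) g] y by [].
by rewrite lE => -[gy _]; rewrite conf_addK.
Qed.

(** Deleting [x] and then [y], or [y] and then [x], leaves the same
    configuration; only the order of summation changes. *)
Lemma pair_sum_sym (F : E * (E * C) -> \bar R) (g : C) :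
  \sum_(x \in points g `&` D)
    \sum_(y \in points (conf_del g x) `&` D)
      F (x, (y, conf_del (conf_del g x) y)) =
  \sum_(x \in points g `&` D)
    \sum_(y \in points (conf_del g x) `&` D)
      F (swap2 (x, (y, conf_del (conf_del g x) y))).
Proof.
have [u lE] := listingP bD (erefl (npoints D g)).
set l := listing D (npoints D g) g in u lE.
have inner x (G : E -> \bar R) : \sum_(y \in points (conf_del g x) `&` D) G y =
    \sum_(y <- l | y != x) G y.
  rewrite -[RHS]big_filter [RHS]fsbig_seq ?filter_uniq//.
  apply: eq_fsbigl; apply/seteqP; split=> y /=; rewrite mem_filter.
    move=> [[gy yx] Dy]; apply/andP; split; first exact/eqP.
    by suff : [set` l] y by []; rewrite lE.
  move=> /andP[/eqP yx yl]; have : [set` l] y by [].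
  by rewrite lE => -[].
rewrite !(fsbig_listing bD) -/l.
under eq_bigr do rewrite inner.
under [RHS]eq_bigr do rewrite inner.
rewrite (exchange_big_dep predT)//=; apply: eq_bigr => x _.
apply: eq_big => y; first by rewrite eq_sym.
move=> _; rewrite /swap2/=; congr F; congr (_, (_, _)).
by apply: conf_ext; rewrite /= setIAC.
Qed.

Definition space_conf : {sigma_finite_measure set (E * C)%type -> \bar R} :=
  sval (sigma_finite_pack (product_sigma_finite mu P)).

Lemma space_confE : space_conf = (mu \x P) :> (_ -> _).
Proof. exact: svalP (sigma_finite_pack (product_sigma_finite mu P)). Qed.

Lemma integral_space_conf (F : E * C -> \bar R) :
  measurable_fun setT F -> (forall z, 0 <= F z) ->
  \int[space_conf]_z F z = \int[mu]_y \int[P]_g F (y, g).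
Proof. by move=> mF F0; rewrite space_confE fubini_tonelli1. Qed.

#[local] Opaque space_conf.

Lemma integral_pair (F : E * (E * C) -> \bar R) :
  measurable_fun setT F -> (forall z, 0 <= F z) ->
  \int[(mu \x space_conf)]_z F z =
  \int[mu]_x \int[mu]_y \int[P]_g F (x, (y, g)).
Proof.
move=> mF F0.
rewrite (@fubini_tonelli1 _ _ _ _ _ mu space_conf F mF F0).
apply: eq_integral => x _; rewrite /fubini_F.
have mx : measurable_fun setT (fun z : E * C => (x, z)).
  by apply: measurable_fun_pair => //; exact: measurable_cst.
by rewrite (@integral_space_conf (fun z => F (x, z)) (measurableT_comp mF mx)).
Qed.

Lemma measurable_int2 (F : E * (E * C) -> \bar R) :
  measurable_fun setT F -> (forall z, 0 <= F z) ->
  measurable_fun setT (fun z : E * E => \int[P]_g F (z.1, (z.2, g))).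
Proof.
move=> mF F0.
apply: (@measurable_fun_fubini_tonelli_F _ _ _ _ _ P
  (fun z : (E * E) * C => F (z.1.1, (z.1.2, z.2)))) => //.
have m : measurable_fun setT
    (fun z : (E * E) * C => (z.1.1, (z.1.2, z.2))).
  apply: measurable_fun_pair.
    exact: (measurableT_comp measurable_fst measurable_fst).
  apply: measurable_fun_pair => //.
  exact: (measurableT_comp measurable_snd measurable_fst).
exact: (measurableT_comp mF m).
Qed.

(** The left sides of the two-point formulas for [F] and [F \o swap2] are equal;
    Fubini's theorem exchanges the two points on the right side. *)
Lemma integral_pair_weight_sym (F : E * (E * C) -> \bar R) :
  measurable_fun setT F -> (forall z, 0 <= F z) ->
  \int[(mu \x space_conf)]_z (F z * (pair_weight z)%:E) =
  \int[(mu \x space_conf)]_z (F z * (swapped_pair_weight z)%:E).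
Proof.
move=> mF F0.
have mv : measurable_fun setT (EFin \o pair_weight).
  by apply/measurable_EFinP; exact: measurable_pair_weight.
have mv' : measurable_fun setT (EFin \o swapped_pair_weight).
  by apply/measurable_EFinP; exact: (measurableT_comp measurable_pair_weight measurable_swap2).
have mFs := measurableT_comp mF measurable_swap2.
have ge0 (f : E * (E * C) -> \bar R) (w : E * (E * C) -> R) :
    (forall z, 0 <= f z) -> (forall z, (0 < w z)%R) ->
    forall z, 0 <= f z * (w z)%:E.
  by move=> f0 w0 z; rewrite mule_ge0// lee_fin ltW.
have v0 z : (0 < pair_weight z)%R by exact: expR_gt0.
have v'0 z : (0 < swapped_pair_weight z)%R by exact: expR_gt0.
have mFv := emeasurable_funM mF mv.
have mFv' := emeasurable_funM mF mv'.
rewrite (integral_pair mFv (ge0 _ _ F0 v0)).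
rewrite (integral_pair mFv' (ge0 _ _ F0 v'0)).
have Fs0 z : 0 <= (F \o swap2) z by exact: F0.
etransitivity; first exact: (esym (two_point_formula mF F0)).
under eq_integral do rewrite pair_sum_sym.
etransitivity; first exact: (two_point_formula mFs Fs0).
have mI := measurable_int2 (emeasurable_funM mFs mv) (ge0 _ _ Fs0 v0).
have I0 (z : E * E) : 0 <= \int[P]_g ((F \o swap2) (z.1, (z.2, g)) *
    (pair_weight (z.1, (z.2, g)))%:E).
  by apply: integral_ge0 => g _; exact: ge0.
exact: (@fubini_tonelli _ _ _ _ _ mu mu _ mI I0).
Qed.

(** Two functions with the same integral over every measurable set agree almost
    everywhere, provided that the integrals are finite.  The weights may fail to
    be integrable, so both are divided by their sum. *)
Lemma pair_weight_sym_ae :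
  (mu \x space_conf) [set z | pair_weight z != swapped_pair_weight z] = 0.
Proof.
have mv := measurable_pair_weight.
have mv' : measurable_fun setT swapped_pair_weight.
  exact: (measurableT_comp measurable_pair_weight measurable_swap2).
have v0 z : (0 < pair_weight z)%R by exact: expR_gt0.
have v'0 z : (0 < swapped_pair_weight z)%R by exact: expR_gt0.
(* The inverse is written as a power, which is known to be measurable. *)
pose q z : R := ((pair_weight z + swapped_pair_weight z) `^ (-1))%R.
have q0 z : (0 <= q z)%R by exact: powR_ge0.
have mq : measurable_fun setT q.
  exact: (measurableT_comp (measurable_powR (R := R) (-1)) (measurable_funD mv mv')).
have qE z : q z = ((pair_weight z + swapped_pair_weight z)^-1)%R.
  by rewrite /q powR_inv1// addr_ge0// ltW.
pose m3 : {measure set (E * (E * C))%type -> \bar R} := (mu \x space_conf).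
have fin3 : m3 setT < +oo.
  have e : m3 setT = mu setT * space_conf setT.
    by rewrite -setXTT; exact: (@product_measure1E _ _ _ _ _ mu space_conf).
  have e2 : space_conf setT = mu setT * P setT.
    rewrite space_confE -setXTT.
    exact: (@product_measure1E _ _ _ _ _ mu P).
  rewrite e e2 probability_setT mule1 lte_mul_pinfty//.
  by rewrite ge0_fin_numE.
pose f z := (q z * pair_weight z)%R; pose f' z := (q z * swapped_pair_weight z)%R.
have mf : measurable_fun setT f by exact: measurable_funM.
have mf' : measurable_fun setT f' by exact: measurable_funM.
have fint : m3.-integrable setT (EFin \o f).
  apply: measurable_bounded_integrable => //.
  exists 1%R; split; first exact: num_real.
  move=> M M1 z _ /=; rewrite /f ger0_norm; last by rewrite mulr_ge0// ltW.
  rewrite qE mulrC ler_pdivrMr; last by rewrite addr_gt0.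
  rewrite (le_trans _ (ler_wpM2r _ (ltW M1)))//.
    by rewrite mul1r lerDl ltW.
  by rewrite addr_ge0// ltW.
have fE A : A `<=` setT -> measurable A ->
    \int[m3]_(z in A) (EFin \o f) z = \int[m3]_(z in A) (EFin \o f') z.
  move=> _ mA.
  have mA1 : measurable_fun setT (fun z => (\1_A z * q z)%:E).
    by apply/measurable_EFinP; apply: measurable_funM.
  have A0 z : 0 <= (\1_A z * q z)%:E by rewrite lee_fin mulr_ge0.
  have e := integral_pair_weight_sym mA1 A0.
  rewrite integral_mkcond [RHS]integral_mkcond !epatch_indic.
  transitivity (\int[m3]_z ((\1_A z * q z)%:E * (pair_weight z)%:E)).
    apply: eq_integral => z _; rewrite -!EFinM; congr EFin.
    by rewrite /f mulrC mulrA.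
  rewrite e; apply: eq_integral => z _; rewrite -!EFinM; congr EFin.
  by rewrite /f' [RHS]mulrC mulrA.
have mf'E : measurable_fun setT (EFin \o f') by exact/measurable_EFinP.
have [N [mN N0 sub]] := integral_ae_eq measurableT fint mf'E fE.
apply: (subset_measure0 _ mN _ N0).
- apply: (@measurable_boolset _ _ (fun z => pair_weight z != swapped_pair_weight z)).
  by apply: measurable_neg; exact: measurable_fun_eqr.
- move=> z /= neq; apply: sub => /= h'; move/eqP: neq; apply.
  have [] := h' I => /eqP; rewrite -subr_eq0 -mulrBr mulf_eq0.
  rewrite qE invr_eq0 gt_eqF ?addr_gt0//= subr_eq0 => /eqP.
  by [].
Qed.

(** * Null sets of tuples *)

(** A set of pairs of a word and a configuration treats all lengths at once, so
    that the action of [swaps] and the recursion on words can be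
    stated without casts; its slice at [n] is a subset of a measurable space. *)
Definition slice n (B : set (seq E * C)) : set (n.-tuple E * C) :=
  [set p | B (tval p.1, p.2)].
Arguments slice : clear implicits.

Definition slice_mass n (B : set (seq E * C)) : \bar R :=
  (power mu n \x P) (slice n B).

Definition head_section (x : E) (B : set (seq E * C)) : set (seq E * C) :=
  [set p | B (x :: p.1, p.2)].

Lemma jointly_measurable_slice n B : measurable (slice n B) ->
  jointly_measurable n (fun t g => (\1_B (t, g))%:E).
Proof.
move=> mB; apply/measurable_EFinP.
have := measurable_indic (R := R) (D := setT) mB.
by congr (measurable_fun _ _); apply/funext => -[t g]; rewrite !indicE.
Qed.

Lemma indic_ge0E (B : set (seq E * C)) t g : 0 <= (\1_B (t, g) : R)%:E.
Proof. by rewrite lee_fin. Qed.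

Lemma slice_massE n B : measurable (slice n B) ->
  slice_mass n B = point_integral n (fun t g => (\1_B (t, g))%:E).
Proof.
move=> mB; rewrite /slice_mass /product_measure1 /point_integral; apply: eq_integral => t _ /=.
have mx : measurable (xsection (slice n B) t) by exact: measurable_xsection.
rewrite -[X in P X]setIT -(integral_indic P measurableT mx).
apply: eq_integral => g _; congr (_%:E); rewrite !indicE; congr ((nat_of_bool _)%:R).
by rewrite /xsection /slice; apply/idP/idP; rewrite !in_setE/= in_setE.
Qed.

Lemma slice_cons n x B : measurable (slice n.+1 B) ->
  measurable (slice n (head_section x B)).
Proof.
move=> mB.
have mp : measurable_fun setT (fun p : n.-tuple E * C => ((x, p.1), p.2)).
  by apply: measurable_fun_pair => //; apply: measurable_fun_pair => //;
    exact: measurable_cst.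
have mc := measurableT_comp (@measurable_cons_pair n) mp.
by have := mc measurableT _ mB; rewrite setTI.
Qed.

Arguments slice_cons {n} x {B} _.

Lemma slice_massS n B : measurable (slice n.+1 B) ->
  slice_mass n.+1 B = \int[mu]_x slice_mass n (head_section x B).
Proof.
move=> mB; rewrite slice_massE// point_integralS; [|exact: jointly_measurable_slice|exact: indic_ge0E].
apply: eq_integral => x _; rewrite slice_massE//.
exact: slice_cons.
Qed.

Lemma measurable_slice_massS n B : measurable (slice n.+1 B) ->
  measurable_fun setT (fun x => slice_mass n (head_section x B)).
Proof.
move=> mB; have := measurable_point_integral (jointly_measurable_slice mB) (indic_ge0E B).
congr (measurable_fun _ _); apply/funext => x; rewrite slice_massE//.
exact: slice_cons.
Qed.

Lemma slice_mass_ge0 n B : 0 <= slice_mass n B.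
Proof. exact: measure_ge0. Qed.

Lemma slice_mass_sub n A B : measurable (slice n A) -> measurable (slice n B) ->
  slice n A `<=` slice n B -> slice_mass n B = 0 -> slice_mass n A = 0.
Proof. by move=> mA mB AB B0; exact: (subset_measure0 mA mB AB B0). Qed.

Lemma slice_mass0 n B : slice n B = set0 -> slice_mass n B = 0.
Proof. by rewrite /slice_mass => ->; rewrite measure0. Qed.

Lemma measurable_slice_empty n :
  measurable (slice n [set p | npoints D p.2 = 0%N]).
Proof.
have := measurableT_comp measurable_npointsD (@measurable_snd _ _ (n.-tuple E) C).
by move=> /(_ measurableT [set 0%N]); rewrite setTI; exact.
Qed.

Lemma slice_addl n A : measurable A ->
  measurable (slice n [set p | npoints D p.2 = 0%N /\ A (addl p.1 p.2)]).
Proof.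
move=> mA.
have mA' : measurable (slice n [set p | A (addl p.1 p.2)]).
  by have := @measurable_addl R d n measurableT _ mA; rewrite setTI.
exact: (measurableI _ _ (@measurable_slice_empty n) mA').
Qed.

Arguments slice_addl n {A} _.

(** The n-point formula for the indicator of [A]: as the weights are
    positive, a null event of configurations with [n] points in [D] is reached
    from a configuration without points in [D] by almost no tuple of
    length [n]. *)
Lemma slice_mass_addl n A : measurable A ->
  P (A `&` [set g | npoints D g = n]) = 0 ->
  slice_mass n [set p | npoints D p.2 = 0%N /\ A (addl p.1 p.2)] = 0.
Proof.
move=> mA A0; pose G : C -> \bar R := EFin \o \1_A.
have mG : measurable_fun setT G.
  by apply/measurable_EFinP; exact: measurable_indic.
have G0 g : 0 <= G g by rewrite lee_fin.
have mn : measurable [set g | npoints D g = n].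
  by have := measurable_npointsD measurableT (Y := [set n]); rewrite setTI; exact.
have := n_point_formula n mG G0.
rewrite (_ : \int[P]_g _ = 0); last first.
  rewrite -[RHS]A0 -[X in P X]setIT.
  rewrite -(integral_indic P measurableT (measurableI _ _ mA mn)).
  apply: eq_integral => g _; rewrite /npoints_indic /G/= -EFinM; congr EFin.
  rewrite !indicE in_setI mulrC -natrM mulnb; congr ((nat_of_bool _)%:R).
  congr (_ && _); apply/idP/idP; first by move=> /eqP; rewrite in_setE.
  by rewrite in_setE => /= ->.
move=> /esym/eqP; rewrite mule_eq0 => /orP[|/eqP J00].
  by rewrite eqe invr_eq0 pnatr_eq0 eqn0Ngt fact_gt0.
have mF := @jointly_measurable_insertion n G mG.
have F0 (p : n.-tuple E * C) : 0 <= insertion G p.1 p.2 by exact: insertion_ge0.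
have I0 : \int[(power mu n \x P)]_p insertion G p.1 p.2 = 0.
  by rewrite (@fubini_tonelli1 _ _ _ _ _ (power mu n) P _ mF F0).
have [N [mN N0 sub]] := (integral_eq0_ae _ mF F0).1 I0.
apply: (subset_measure0 _ mN _ N0); first exact: slice_addl.
move=> [t g] /= [g0 Ag]; apply: sub => /=.
rewrite /insertion /npoints_indic g0 eqxx mul1e /G/= indicE mem_set// mule1.
by move=> [] /eqP; rewrite gt_eqF// expR_gt0.
Qed.

Lemma prod_null_xsection d1 d2 (T1 : measurableType d1) (T2 : measurableType d2)
    (m1 : {measure set T1 -> \bar R}) (m2 : {sigma_finite_measure set T2 -> \bar R})
    (A : set (T1 * T2)) : measurable A -> (m1 \x m2) A = 0 ->
  {ae m1, forall x, m2 (xsection A x) = 0}.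
Proof.
move=> mA A0; apply/(integral_eq0_ae m1 (f := fun x => m2 (xsection A x))) => //.
exact: measurable_fun_xsection.
Qed.

Lemma measurable_swaps d1 (T : measurableType d1) w n :
  {f : n.-tuple T -> n.-tuple T |
    measurable_fun setT f & forall t, tval (f t) = swaps w t}.
Proof.
elim: w => [|i w [f mf fE]]; first by exists id.
have [f' mf' f'E] := measurable_swap_at T i n.
exists (f' \o f); first exact: measurableT_comp.
by move=> t /=; rewrite f'E fE.
Qed.

Definition order_sensitive (w : seq nat) : set (seq E * C) :=
  [set p | npoints D p.2 = 0%N /\ weight (swaps w p.1) p.2 <> weight p.1 p.2].

Definition preswap (w : seq nat) (B : set (seq E * C)) : set (seq E * C) :=
  [set p | B (swaps w p.1, p.2)].

Lemma measurable_swaps_pair w n : {f : n.-tuple E * C -> n.-tuple E * C |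
  measurable_fun setT f &
  forall p, tval (f p).1 = swaps w p.1 /\ (f p).2 = p.2}.
Proof.
have [f mf fE] := @measurable_swaps _ E w n.
exists (fun p => (f p.1, p.2)).
  apply: measurable_fun_pair => //.
  exact: (measurableT_comp mf measurable_fst).
by move=> p; rewrite /= fE.
Qed.

Lemma slice_preswap n w B : measurable (slice n B) ->
  measurable (slice n (preswap w B)).
Proof.
move=> mB; have [f mf fE] := measurable_swaps_pair w n.
rewrite (_ : slice n _ = f @^-1` slice n B).
  by rewrite -[X in measurable X]setTI; exact: mf.
apply/seteqP; split=> p; rewrite /slice /preswap/=; have [-> ->] := fE p; by [].
Qed.

Lemma slice_order_sensitive n w : measurable (slice n (order_sensitive w)).
Proof.
have [f mf fE] := measurable_swaps_pair w n.
have mw := @measurable_weight n.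
have m1 : measurable [set p : n.-tuple E * C |
    weight (f p).1 (f p).2 != weight p.1 p.2].
  apply: (@measurable_boolset _ _
    (fun p => weight (f p).1 (f p).2 != weight p.1 p.2)).
  apply: measurable_neg; apply: measurable_fun_eqr => //.
  exact: (measurableT_comp mw mf).
rewrite (_ : slice n _ = slice n [set p | npoints D p.2 = 0%N] `&`
    [set p : n.-tuple E * C | weight (f p).1 (f p).2 != weight p.1 p.2]).
  by apply: measurableI => //; exact: measurable_slice_empty.
apply/seteqP; split=> p; rewrite /slice/=; have [-> ->] := fE p.
  by move=> [? /eqP].
by move=> [? /eqP].
Qed.

Arguments slice_order_sensitive : clear implicits.

Lemma weight_cons2 x y a g :
  weight (x :: y :: a) g = (weight a g * weight [:: x; y] (addl a g))%R.
Proof.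
rewrite [in RHS]weight_pair (weight_cons x) (weight_cons y) addl_cons -mulrA.
by congr (_ * _)%R; rewrite mulrC.
Qed.

(** For a transposition of the two heads, [weight (x :: y :: a) g] is
    [weight a g] times the weight of the pair [x, y] in the presence of [g + a].
    The latter is symmetric off a null set of configurations with [n] points in
    [D], and [slice_mass_addl] brings it back to null sets of tuples.  A
    transposition further down is handled one entry at a time, as the weight of
    the head does not depend on the order of the tail. *)
Lemma slice_mass_swap i n : slice_mass n (order_sensitive [:: i]) = 0.
Proof.
elim: i n => [|i IH] n.
  case: n => [|[|n]].
  - apply: slice_mass0; apply/seteqP; split=> // -[t g]; rewrite /slice/=.
    by rewrite [t]tuple0 => -[].
  - apply: slice_mass0; apply/seteqP; split=> // -[t g]; rewrite /slice/=.
    by case/tupleP: t => x t; rewrite [t]tuple0 => -[].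
  have mbad := slice_order_sensitive n.+2 [:: 0%N].
  rewrite (slice_massS mbad).
  apply/(integral_eq0_ae mu (measurable_slice_massS mbad)); first by move=> x; exact: slice_mass_ge0.
  pose A3 := [set z | pair_weight z != swapped_pair_weight z].
  have mA3 : measurable A3.
    apply: (@measurable_boolset _ _ (fun z => pair_weight z != swapped_pair_weight z)).
    apply: measurable_neg; apply: measurable_fun_eqr; first exact: measurable_pair_weight.
    exact: (measurableT_comp measurable_pair_weight measurable_swap2).
  have := prod_null_xsection mA3 pair_weight_sym_ae; apply: filterS => x.
  rewrite space_confE => x0.
  have mx : measurable (xsection A3 x) by exact: measurable_xsection.
  have mbx := slice_cons x mbad.
  rewrite (slice_massS mbx).
  apply/(integral_eq0_ae mu (measurable_slice_massS mbx)); first by move=> y; exact: slice_mass_ge0.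
  have := prod_null_xsection mx x0; apply: filterS => y y0.
  have my : measurable (xsection (xsection A3 x) y) by exact: measurable_xsection.
  apply: (slice_mass_sub (slice_cons y mbx) (slice_addl n my)); last first.
    apply: slice_mass_addl => //; apply: (subset_measure0 _ my _ y0).
      apply: measurableI => //.
      by have := measurable_npointsD measurableT (Y := [set n]); rewrite setTI; exact.
    exact: subIsetl.
  move=> [a g]; rewrite /slice /head_section /order_sensitive/= => -[g0 neq]; split => //.
  have hA : A3 (x, (y, addl a g)).
    rewrite /A3 /mkset; apply/eqP => e; apply: neq.
    rewrite (weight_cons2 y x) (weight_cons2 x y); congr (_ * _)%R.
    exact: (esym e).
  rewrite /xsection/=; apply/mem_set => /=; exact/mem_set.
case: n => [|n].
  apply: slice_mass0; apply/seteqP; split=> // -[t g]; rewrite /slice/=.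
  by rewrite [t]tuple0 => -[].
have mbad := slice_order_sensitive n.+1 [:: i.+1].
rewrite (slice_massS mbad); apply: integral0_eq => x _.
apply: (slice_mass_sub (slice_cons x mbad) (slice_order_sensitive n [:: i])) => //.
move=> [t g]; rewrite /slice /head_section /order_sensitive/= => -[g0 neq]; split => // e.
apply: neq; rewrite !weight_cons e; congr (_ * point_weight x _)%R.
by apply: eq_addl => y; exact: (perm_mem (perm_swap_at i t)).
Qed.

Lemma measurable_slice_massSS n B : measurable (slice n.+2 B) ->
  measurable_fun setT (fun z : E * E => slice_mass n (head_section z.2 (head_section z.1 B))).
Proof.
move=> mB; have mJ := measurable_point_integrand (jointly_measurable_slice mB) (indic_ge0E B).
have mc : measurable_fun setT (fun p : (E * E) * n.-tuple E =>
    [tuple of p.1.1 :: [tuple of p.1.2 :: p.2]]).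
  apply: measurable_cons.
    exact: (measurableT_comp measurable_fst measurable_fst).
  apply: measurable_cons; last exact: measurable_snd.
  exact: (measurableT_comp measurable_snd measurable_fst).
have m2 := measurableT_comp mJ mc.
have I0 (z : (E * E) * n.-tuple E) : 0 <= \int[P]_g
    (\1_B (z.1.1 :: z.1.2 :: tval z.2, g))%:E.
  by apply: integral_ge0 => g _; exact: indic_ge0E.
have := @measurable_fun_fubini_tonelli_F _ _ _ _ _ (power mu n) _ m2 I0.
congr (measurable_fun _ _); apply/funext => z; rewrite slice_massE//.
exact: (slice_cons z.2 (slice_cons z.1 mB)).
Qed.

(** The product measure is invariant under permutations of the coordinates. *)
Lemma slice_mass_preswap1 i n B : measurable (slice n B) ->
  slice_mass n (preswap [:: i] B) = slice_mass n B.
Proof.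
elim: i n B => [|i IH] n B mB.
  case: n mB => [|[|n]] mB.
  - rewrite /slice_mass; congr (_ _); apply/seteqP; split=> -[t g];
      by rewrite /slice /preswap/= [t]tuple0.
  - rewrite /slice_mass; congr (_ _); apply/seteqP; split=> -[t g];
      by rewrite /slice /preswap/=; case/tupleP: t => x t; rewrite [t]tuple0.
  have mp := slice_preswap [:: 0%N] mB.
  rewrite (slice_massS mp) (slice_massS mB).
  transitivity (\int[mu]_x \int[mu]_y slice_mass n (head_section x (head_section y B))).
    by apply: eq_integral => x _; rewrite (slice_massS (slice_cons x mp)).
  transitivity (\int[mu]_x \int[mu]_y slice_mass n (head_section y (head_section x B))); last first.
    by apply: eq_integral => x _; rewrite (slice_massS (slice_cons x mB)).
  have n0 (z : E * E) : 0 <= slice_mass n (head_section z.2 (head_section z.1 B)) by exact: slice_mass_ge0.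
  exact: (esym (@fubini_tonelli _ _ _ _ _ mu mu _ (measurable_slice_massSS mB) n0)).
case: n mB => [|n] mB.
  rewrite /slice_mass; congr (_ _); apply/seteqP; split=> -[t g];
    by rewrite /slice /preswap/= [t]tuple0.
rewrite (slice_massS (slice_preswap [:: i.+1] mB)) (slice_massS mB).
apply: eq_integral => x _; exact: (IH n (head_section x B) (slice_cons x mB)).
Qed.

Lemma slice_mass_preswap w n B : measurable (slice n B) ->
  slice_mass n (preswap w B) = slice_mass n B.
Proof.
elim: w B => [|i w IH] B mB.
  by rewrite /slice_mass; congr (_ _); apply/seteqP; split=> -[t g].
by rewrite -(slice_mass_preswap1 i mB) -(IH _ (slice_preswap [:: i] mB)).
Qed.

Lemma slice_mass_setU n A B : measurable (slice n A) -> measurable (slice n B) ->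
  slice_mass n A = 0 -> slice_mass n B = 0 -> slice_mass n (A `|` B) = 0.
Proof.
move=> mA mB A0 B0; apply/eqP; rewrite -measure_le0.
apply: (le_trans (measureU2 _ mA mB)).
by rewrite -[leRHS]adde0; apply: leeD; [rewrite -A0|rewrite -B0].
Qed.

Lemma slice_setU n A B : measurable (slice n A) -> measurable (slice n B) ->
  measurable (slice n (A `|` B)).
Proof. exact: measurableU. Qed.

(** If the word [i :: w] changes the weight, then either [w] does or the
    transposition [i] changes the weight of the tuple reordered by [w]; both
    happen on null sets. *)
Lemma slice_mass_order_sensitive w n : slice_mass n (order_sensitive w) = 0.
Proof.
elim: w => [|i w IH].
  by apply: slice_mass0; apply/seteqP; split=> // -[t g] [].
have mp := slice_preswap w (slice_order_sensitive n [:: i]).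
apply: (@slice_mass_sub n _ (preswap w (order_sensitive [:: i]) `|` order_sensitive w)).
- exact: slice_order_sensitive.
- by apply: slice_setU => //; exact: slice_order_sensitive.
- move=> [t g]; rewrite /slice /order_sensitive /preswap/= => -[g0 neq].
  have [e|ne] := pselect (weight (swaps w t) g = weight t g); last by right.
  by left; split => // e'; apply: neq; rewrite e'.
- have p0 : slice_mass n (preswap w (order_sensitive [:: i])) = 0.
    by rewrite (slice_mass_preswap w (slice_order_sensitive n [:: i])); exact: slice_mass_swap.
  exact: (slice_mass_setU mp (slice_order_sensitive n w) p0 IH).
Qed.

Definition ever_order_sensitive : set (seq E * C) :=
  [set p | npoints D p.2 = 0%N /\
     exists w, weight (swaps w p.1) p.2 <> weight p.1 p.2].

Lemma slice_ever_order_sensitiveE n : slice n ever_order_sensitive =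
  \bigcup_w slice n (order_sensitive w).
Proof.
apply/seteqP; split=> -[t g]; rewrite /slice /ever_order_sensitive /order_sensitive/=.
  by move=> [g0 [w neq]]; exists w.
by move=> [w _ [g0 neq]]; split => //; exists w.
Qed.

Lemma slice_ever_order_sensitive n : measurable (slice n ever_order_sensitive).
Proof.
rewrite slice_ever_order_sensitiveE; apply: countable_bigcupT_measurable => // w.
exact: slice_order_sensitive.
Qed.

Lemma slice_mass_ever_order_sensitive n : slice_mass n ever_order_sensitive = 0.
Proof.
pose F k := if choice.unpickle k is Some w then slice n (order_sensitive w) else set0.
have mF k : measurable (F k).
  by rewrite /F; case: choice.unpickle => // w; exact: slice_order_sensitive.
have F0 k : (power mu n \x P) (F k) = 0.
  rewrite /F; case: choice.unpickle => [w|]; last exact: measure0.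
  exact: slice_mass_order_sensitive.
apply/eqP; rewrite -measure_le0.
have -> : slice n ever_order_sensitive = \bigcup_k F k.
  rewrite slice_ever_order_sensitiveE; apply/seteqP; split=> p [w _ pw].
    by exists (choice.pickle w); rewrite // /F choice.pickleK.
  by move: pw; rewrite /F; case: choice.unpickle => // w'; exists w'.
have mU : measurable (\bigcup_k F k) by exact: bigcupT_measurable.
apply: (le_trans (measure_sigma_subadditive _ mF mU (@subset_refl _ _))).
by rewrite eseries0// => k _ _; exact: F0.
Qed.

(** * Exchangeable tuples *)

(** The condition on the number of points says that the entries of [t] are
    distinct. *)
Definition exchangeable (g : C) (t : seq E) : Prop :=
  [/\ {in t, forall x, D x}, npoints D (conf_seq t) = size t &
      forall w, weight (swaps w t) g = weight t g].

Lemma measurable_exchangeable n :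
  measurable [set p : n.-tuple E * C | exchangeable p.2 p.1].
Proof.
have m1 : measurable (@tuples_in _ _ D n `*` [set: C]).
  by apply: measurableX => //; apply: measurable_tuples_in; exact: bD.1.
have m2 : measurable ([set t : n.-tuple E | npoints D (conf_tuple t) = n] `*` [set: C]).
  apply: measurableX => //.
  have := measurableT_comp measurable_npointsD (@measurable_conf_tuple R d n).
  by move=> /(_ measurableT [set n]); rewrite setTI; exact.
have mw w : measurable [set p : n.-tuple E * C | weight (swaps w p.1) p.2 = weight p.1 p.2].
  have [f mf fE] := measurable_swaps_pair w n.
  have := @measurable_boolset _ _ (fun p : n.-tuple E * C =>
     weight (f p).1 (f p).2 == weight p.1 p.2).
  have mwn := @measurable_weight n.
  have mfw := measurableT_comp mwn mf.
  move=> /(_ (measurable_fun_eqr mfw mwn)); congr measurable.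
  apply/seteqP; split=> p; rewrite /mkset; have [-> ->] := fE p.
    by move=> /eqP.
  by move=> ->.
have m3 : measurable (\bigcap_w [set p : n.-tuple E * C |
    weight (swaps w p.1) p.2 = weight p.1 p.2]).
  rewrite -[X in measurable X]setCK setC_bigcap; apply: measurableC.
  by apply: countable_bigcupT_measurable => // w; exact: measurableC.
have := measurableI _ _ m1 (measurableI _ _ m2 m3).
congr measurable; apply/seteqP; split=> -[t g].
  move=> [[tD _] [[tn _] tw]]; split => //; first by rewrite size_tuple.
  by move=> w; exact: (tw w I).
move=> [tD tn tw]; split; first by split.
split; last by move=> w _; exact: tw.
by split => //; rewrite /= -[RHS](size_tuple t).
Qed.

Definition nonexchangeable : set (seq E * C) :=
  [set p | npoints D p.2 = 0%N /\ ~ exchangeable p.2 p.1].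

Lemma slice_nonexchangeable n : measurable (slice n nonexchangeable).
Proof.
have := measurableI _ _ (@measurable_slice_empty n)
  (measurableC (@measurable_exchangeable n)).
by congr measurable; apply/seteqP; split=> -[t g].
Qed.

Lemma npoints_addl t g : npoints D g = 0%N -> npoints D (addl t g) =
  npoints D (conf_seq t).
Proof.
move=> /npoints0 -/(_ bD.2) g0.
by rewrite /npoints /= setIUl g0 set0U.
Qed.

(** A tuple of length [n] with a repeated entry adds fewer than [n] points to a
    configuration that has none in [D]; [slice_mass_addl], applied to the event
    of not having [n] points, shows that such tuples are negligible. *)
Lemma slice_mass_nonexchangeable n : slice_mass n nonexchangeable = 0.
Proof.
pose A := [set g : C | npoints D g <> n].
have mA : measurable A.
  have := measurable_npointsD measurableT (Y := ~` [set n]).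
  by rewrite setTI; exact.
have A0 : slice_mass n [set p | npoints D p.2 = 0%N /\ A (addl p.1 p.2)] = 0.
  apply: slice_mass_addl => //; rewrite (_ : A `&` _ = set0) ?measure0//.
  by apply/seteqP; split=> // g [].
pose B : set (seq E * C) := [set p | ~ {in p.1, forall x, D x}].
have mB : measurable (slice n B).
  rewrite (_ : slice n B = ~` @tuples_in _ _ D n `*` [set: C]).
    apply: measurableX => //; apply: measurableC.
    by apply: measurable_tuples_in; exact: bD.1.
  by apply/seteqP; split=> -[t g] //= [].
have B0 : slice_mass n B = 0.
  rewrite /slice_mass (_ : slice n B = ~` @tuples_in _ _ D n `*` [set: C]).
    rewrite (@product_measure1E _ _ _ _ _ (power mu n) P)//.
      rewrite [X in X * _](@power_supported _ _ _ mu D) ?mul0e//.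
      exact: bD.1.
    by apply: measurableC; apply: measurable_tuples_in; exact: bD.1.
  by apply/seteqP; split=> -[t g] //= [].
have mAs := slice_addl n mA.
have mAB := slice_setU mAs mB.
have AB0 := slice_mass_setU mAs mB A0 B0.
have mall := @slice_ever_order_sensitive n.
apply: (slice_mass_sub (@slice_nonexchangeable n) (slice_setU mAB mall)); last first.
  exact: (slice_mass_setU mAB mall AB0 (slice_mass_ever_order_sensitive n)).
move=> [t g] [/= g0 ng].
have [tD|tD] := pselect {in tval t, forall x, D x}; last by left; right.
have [tn|tn] := pselect (npoints D (addl t g) = n); last by left; left.
right; split => //; apply: contrapT => nw; apply: ng; split => //.
  by rewrite -(npoints_addl t g0)/= tn size_tuple.
by move=> w; apply: contrapT => wt; apply: nw; exists w.
Qed.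

(** By [integral_outside] the law of the configuration outside [D] is absolutely
    continuous with respect to the law restricted to the event that [D] is
    empty. *)
Lemma outside_null (A : set C) : measurable A ->
  P (A `&` [set g | npoints D g = 0%N]) = 0 -> P (outside @^-1` A) = 0.
Proof.
move=> mA A0.
have mk : measurable_fun setT (\1_A : C -> R) by exact: measurable_indic.
have k0 g : (0 <= (\1_A g : R))%R by [].
have mo : measurable (outside @^-1` A).
  by rewrite -[X in measurable X]setTI; exact: measurable_outside.
rewrite -[X in P X]setIT -(integral_indic P measurableT mo).
transitivity (\int[P]_g (\1_A (outside g) : R)%:E).
  by apply: eq_integral => g _; rewrite !indicE.
rewrite (integral_outside mk k0).
have mn : measurable [set g : C | npoints D g = 0%N].
  by have := measurable_npointsD measurableT (Y := [set 0%N]); rewrite setTI; exact.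
rewrite (@ge0_integral_off_null _ _ _ P (A `&` [set g | npoints D g = 0%N]) _ (cst 0)).
- by rewrite integral0.
- exact: measurableI.
- exact: A0.
- move=> g; apply: mule_ge0; first exact: npoints_indic_ge0.
  by rewrite mule_ge0 ?lee_fin// gibbs_sum_ge0.
- by [].
move=> g nAg; rewrite /npoints_indic; case: eqP => [g0|]; last by rewrite mul0e.
rewrite indicE memNset ?mul0e ?mule0// => Ag.
by apply: nAg.
Qed.

Lemma measurable_empty_region : measurable [set g : C | npoints D g = 0%N].
Proof.
by have := measurable_npointsD measurableT (Y := [set 0%N]); rewrite setTI; exact.
Qed.

Definition nonexchangeable_mass n (g : C) : \bar R :=
  power mu n [set t : n.-tuple E | ~ exchangeable g t].

Lemma measurable_nonexchangeable n g :
  measurable [set t : n.-tuple E | ~ exchangeable g t].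
Proof.
have mp : measurable_fun setT (fun t : n.-tuple E => (t, g)).
  by apply: measurable_fun_pair => //; exact: measurable_cst.
by have := mp measurableT _ (measurableC (@measurable_exchangeable n)); rewrite setTI.
Qed.

Lemma nonexchangeable_massE n g : nonexchangeable_mass n g =
  \int[power mu n]_t (\1_[set p : n.-tuple E * C | ~ exchangeable p.2 p.1] (t, g) : R)%:E.
Proof.
rewrite /nonexchangeable_mass -[X in power mu n X]setIT.
rewrite -(integral_indic (power mu n) measurableT (@measurable_nonexchangeable n g)).
by apply: eq_integral => t _; rewrite !indicE.
Qed.

Lemma measurable_nonexchangeable_mass n :
  measurable_fun setT (nonexchangeable_mass n).
Proof.
have mB := measurableC (@measurable_exchangeable n).
have mi : measurable_fun setT (fun p : n.-tuple E * C =>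
    (\1_[set p : n.-tuple E * C | ~ exchangeable p.2 p.1] p : R)%:E).
  by apply/measurable_EFinP; exact: measurable_indic.
have i0 (p : n.-tuple E * C) :
    0 <= (\1_[set p : n.-tuple E * C | ~ exchangeable p.2 p.1] p : R)%:E.
  by rewrite lee_fin.
have := @measurable_fun_fubini_tonelli_G _ _ _ _ _ (power mu n) _ mi i0.
by congr (measurable_fun _ _); apply/funext => g; rewrite nonexchangeable_massE.
Qed.

Lemma nonexchangeable_mass_ae_empty n : {ae P, forall g, npoints D g = 0%N ->
  nonexchangeable_mass n g = 0}.
Proof.
have mB := @slice_nonexchangeable n.
have mi := jointly_measurable_slice mB.
have i0 (p : n.-tuple E * C) : 0 <= (\1_nonexchangeable (tval p.1, p.2) : R)%:E.
  by rewrite lee_fin.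
have := slice_mass_nonexchangeable n; rewrite (slice_massE mB) /point_integral.
rewrite (@fubini_tonelli _ _ _ _ _ (power mu n) P _ mi i0).
have mG := @measurable_fun_fubini_tonelli_G _ _ _ _ _ (power mu n) _ mi i0.
have G0 x : 0 <= fubini_G (power mu n)
    (fun p : n.-tuple E * C => (\1_nonexchangeable (tval p.1, p.2) : R)%:E) x.
  by apply: integral_ge0 => t _; exact: i0.
move=> /(integral_eq0_ae P mG G0).1; apply: filterS => g ug g0.
rewrite nonexchangeable_massE -[RHS]ug.
apply: eq_integral => t _; rewrite /= !indicE; congr (_%:E).
suff -> : ((t, g) \in [set p : n.-tuple E * C | ~ exchangeable p.2 p.1]) =
  ((tval t, g) \in nonexchangeable) by [].
apply/idP/idP => /set_mem h'; apply/mem_set; first by split.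
by case: h'.
Qed.

Lemma ae_empty_region (A : set C) : measurable A ->
  {ae P, forall g, npoints D g = 0%N -> A g} -> {ae P, forall g, A (outside g)}.
Proof.
move=> mA [N [mN N0 sub]].
have mAC := measurableC mA.
exists (outside @^-1` (~` A)); split.
- by rewrite -[X in measurable X]setTI; exact: measurable_outside.
- apply: outside_null => //.
  apply: (subset_measure0 _ mN _ N0).
    by apply: measurableI => //; exact: measurable_empty_region.
  by move=> g [/= nA g0]; apply: sub => /= h'; apply: nA; exact: h'.
- by move=> g.
Qed.

Lemma nonexchangeable_mass_ae :
  {ae P, forall g, forall n, nonexchangeable_mass n (outside g) = 0}.
Proof.
apply: ae_foralln => n; apply: (@ae_empty_region [set g | nonexchangeable_mass n g = 0]).
  have := @measurable_nonexchangeable_mass n measurableT _ (emeasurable_set1 0).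
  by rewrite setTI.
exact: nonexchangeable_mass_ae_empty.
Qed.

(** * The Gibbs mean *)

(** The empty tuple contributes [1]. *)
Lemma partition_sum_ge1 g : 1 <= partition_sum g.
Proof.
have t0 n : 0 <= (n`!%:R^-1)%:E * gibbs_term (cst 1) n g.
  by apply: scaled_gibbs_term_ge0 => g'; rewrite lee_fin ler01.
have := @nneseries_lim_ge R (fun n => (n`!%:R^-1)%:E * gibbs_term (cst 1) n g)
  xpredT 0 1 (fun n _ _ => t0 n).
apply: le_trans; rewrite big_nat1 fact0 invr1 mul1e /gibbs_term.
rewrite ge0_integral_power0.
- by rewrite /weight/= mulr0 oppr0 expR0 mul1e.
- have mg : measurable_fun setT (fun t : 0.-tuple E => (t, g)).
    by apply: measurable_fun_pair => //; exact: measurable_cst.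
  exact: (measurableT_comp (@measurable_gibbs_integrand (cst 1) 0
    (measurable_cst _)) mg).
- by move=> t; rewrite mule_ge0 ?lee_fin ?expR_ge0 ?ler01.
Qed.

Lemma measurable_partition_sum : measurable_fun setT partition_sum.
Proof.
by apply: measurable_gibbs_sum; [exact: measurable_cst|move=> g; rewrite lee_fin ler01].
Qed.

(** For the constant function [1], [integral_gibbs_sum] says that the integral of
    the partition sum over the event that [D] is empty is [1]. *)
Lemma partition_sum_fin_ae_empty :
  {ae P, forall g, npoints D g = 0%N -> partition_sum g < +oo}.
Proof.
have z0 g : 0 <= partition_sum g by rewrite (le_trans _ (partition_sum_ge1 g)).
have mI : measurable_fun setT (fun g => npoints_indic 0 g * partition_sum g).
  by apply: emeasurable_funM; [exact: measurable_npoints_indic|exact: measurable_partition_sum].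
have I0 g : 0 <= npoints_indic 0 g * partition_sum g by rewrite mule_ge0 ?npoints_indic_ge0.
have int1 : \int[P]_g (npoints_indic 0 g * partition_sum g) = 1.
  have c0 (g : C) : 0 <= (cst 1 g : \bar R) by rewrite lee_fin ler01.
  rewrite -(integral_gibbs_sum (measurable_cst _) c0) integral_cst// mul1e.
  exact: probability_setT.
have : P.-integrable setT (fun g => npoints_indic 0 g * partition_sum g).
  apply/integrableP; split => //.
  rewrite (eq_integral (fun g => npoints_indic 0 g * partition_sum g)) ?int1 ?ltry//.
  by move=> g _; rewrite gee0_abs.
move=> /(integrable_ae measurableT); apply: filterS => g h' g0.
have := h' I; rewrite /npoints_indic g0 eqxx mul1e ge0_fin_numE//.
Qed.

Lemma partition_sum_fin_ae : {ae P, forall g, partition_sum (outside g) < +oo}.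
Proof.
apply: (@ae_empty_region [set g | partition_sum g < +oo]).
  have := emeasurable_fun_infty_o measurableT measurable_partition_sum +oo.
  by rewrite setTI.
exact: partition_sum_fin_ae_empty.
Qed.

Lemma gibbs_sum_le G (M : R) g : measurable_fun setT G ->
  (forall g, 0 <= G g) -> (0 <= M)%R -> (forall g, G g <= M%:E) ->
  gibbs_sum G g <= M%:E * partition_sum g.
Proof.
move=> mG G0 M0 GM.
have c0 g' : 0 <= (cst 1 g' : \bar R) by rewrite lee_fin ler01.
have mg n : measurable_fun setT (fun t : n.-tuple E => (t, g)).
  by apply: measurable_fun_pair => //; exact: measurable_cst.
have mi G' n (mG' : measurable_fun setT G') :=
  measurableT_comp (@measurable_gibbs_integrand G' n mG') (mg n).
rewrite /partition_sum /gibbs_sum -nneseriesZl; last first.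
  by move=> n _; exact: scaled_gibbs_term_ge0.
apply: lee_nneseries => n; first by move=> *; exact: scaled_gibbs_term_ge0.
move=> _.
rewrite muleCA lee_pmul ?lee_fin ?fact_inv_ge0//; first exact: gibbs_term_ge0.
rewrite /gibbs_term -ge0_integralZl//; last 2 first.
- exact: (mi (cst 1) n (measurable_cst _)).
- by move=> t _; rewrite mule_ge0 ?lee_fin ?expR_ge0 ?ler01.
apply: ge0_le_integral => //.
- by move=> t _; rewrite mule_ge0// lee_fin expR_ge0.
- exact: (mi G n mG).
- apply: emeasurable_funM; first exact: measurable_cst.
  exact: (mi (cst 1) n (measurable_cst _)).
- move=> t _; rewrite mule1 muleC lee_pmul ?lee_fin ?expR_ge0//.
Qed.

(** Average of [G] under the specification in [D] with the boundary
    condition [g]. *)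
Definition gibbs_mean (G : C -> \bar R) (g : C) : R :=
  (fine (gibbs_sum G g) / fine (partition_sum g))%R.

Lemma measurable_gibbs_mean G : measurable_fun setT G ->
  (forall g, 0 <= G g) -> measurable_fun setT (gibbs_mean G).
Proof.
move=> mG G0.
rewrite (_ : gibbs_mean G = fun g =>
    (fine (gibbs_sum G g) * (fine (partition_sum g)) `^ (-1))%R).
  apply: measurable_funM.
    exact: (measurableT_comp (fine_measurable _) (measurable_gibbs_sum mG G0)).
  apply: (measurableT_comp (measurable_powR (R := R) (-1))).
  exact: (measurableT_comp (fine_measurable _) measurable_partition_sum).
apply/funext => g; rewrite powR_inv1// fine_ge0//.
by rewrite (le_trans _ (partition_sum_ge1 g)).
Qed.

Lemma gibbs_mean_ge0 G g : (forall g, 0 <= G g) -> (0 <= gibbs_mean G g)%R.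
Proof.
move=> G0; rewrite divr_ge0// fine_ge0//; first exact: gibbs_sum_ge0.
by rewrite (le_trans _ (partition_sum_ge1 g)).
Qed.

(** The law outside [D] has density [partition_sum], which cancels against the
    denominator of the Gibbs mean; what is left is [integral_gibbs_sum]. *)
Lemma integral_gibbs_mean G (M : R) : measurable_fun setT G ->
  (forall g, 0 <= G g) -> (0 <= M)%R -> (forall g, G g <= M%:E) ->
  \int[P]_g (gibbs_mean G (outside g))%:E = \int[P]_g G g.
Proof.
move=> mG G0 M0 GM.
have z0 g : 0 <= partition_sum g by rewrite (le_trans _ (partition_sum_ge1 g)).
rewrite (integral_outside (measurable_gibbs_mean mG G0)); last first.
  by move=> g; exact: gibbs_mean_ge0.
rewrite (integral_gibbs_sum mG G0).
have [N [mN N0 sub]] := partition_sum_fin_ae_empty.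
apply: (ge0_integral_off_null mN N0).
- by move=> g; rewrite mule_ge0 ?npoints_indic_ge0// mule_ge0// lee_fin gibbs_mean_ge0.
- by move=> g; rewrite mule_ge0 ?npoints_indic_ge0//; exact: gibbs_sum_ge0.
move=> g nN; rewrite /npoints_indic; case: eqP => [g0|]; last by rewrite !mul0e.
have zoo : partition_sum g < +oo.
  by apply: contrapT => zoo; apply: nN; apply: sub => /= /(_ g0).
have zfin : partition_sum g \is a fin_num by rewrite ge0_fin_numE.
have dfin : gibbs_sum G g \is a fin_num.
  rewrite ge0_fin_numE; last exact: gibbs_sum_ge0.
  rewrite (le_lt_trans (gibbs_sum_le g mG G0 M0 GM))//.
  by rewrite lte_mul_pinfty ?lee_fin.
congr (_ * _); rewrite /gibbs_mean -[X in _ * X = _](fineK zfin) -EFinM.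
rewrite divfK ?fineK//; rewrite gt_eqF// fine_gt0// zoo andbT.
by rewrite (lt_le_trans _ (partition_sum_ge1 g))// lte01.
Qed.

(** * The Gibbs specification as a Poisson integral *)

Lemma exchangeable_perm s t g : perm_eq s t -> exchangeable g t ->
  exchangeable g s /\ weight s g = weight t g.
Proof.
move=> st [tD tn tw]; have [w sE] := perm_eq_swaps st.
split; last by rewrite sE tw.
split.
- by move=> x xs; apply: tD; rewrite -(perm_mem st).
- rewrite (perm_size st) -tn; congr npoints; apply: conf_ext => /=.
  by apply/seteqP; split=> x /=; rewrite (perm_mem st).
- by move=> w'; rewrite sE -swaps_cat !tw.
Qed.

(** The enumeration of the points of [conf_seq t] that is fixed by choice is a
    permutation of [t], and [t] is exchangeable. *)
Lemma weight_fset_set t g : exchangeable g t ->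
  expR (- (beta * energy_seq h (fset_set (conf_seq t)) g)) = weight t g.
Proof.
move=> gt; have [tD tn _] := gt.
set l : seq E := fset_set (conf_seq t).
have lt : perm_eq (rev l) t.
  apply: uniq_perm.
  - by rewrite rev_uniq; exact: fset_uniq.
  - exact: (uniq_conf_seq bD tD tn).
  - move=> x; rewrite mem_rev /l in_fset_set/=; last exact: finite_seq.
    by apply/idP/idP => [/set_mem|] xt; [|apply/mem_set].
rewrite -(exchangeable_perm lt gt).2 /weight -energy_seq_rev revK.
by [].
Qed.

(** [poisson_integral] for the set of tuples that are exchangeable in the presence
    of [g] outside [D]. *)
Lemma gibbs_integral (F : C -> R) (c : R) g : measurable_fun setT F ->
  (forall g, 0 <= F g)%R -> (0 <= c)%R ->
  (forall n, nonexchangeable_mass n (outside g) = 0) ->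
  \int[poisson_process D]_eta (c * F (conf_union eta (outside g)) *
     expR (- (beta * energy_seq h (fset_set eta) (outside g))))%:E =
  (void_probability D * c)%:E * gibbs_sum (EFin \o F) (outside g).
Proof.
move=> mF F0 c0 ug; set g' := outside g.
have mEF : measurable_fun setT (EFin \o F) by apply/measurable_EFinP.
have EF0 g1 : 0 <= (EFin \o F) g1 by rewrite lee_fin F0.
pose phi (t : seq E) : \bar R := c%:E * ((weight t g')%:E * (EFin \o F) (addl t g')).
have mg n : measurable_fun setT (fun t : n.-tuple E => (t, g')).
  by apply: measurable_fun_pair => //; exact: measurable_cst.
have mi n := measurableT_comp (@measurable_gibbs_integrand (EFin \o F) n mEF) (mg n).
rewrite (@poisson_integral _ _ mu D bD muE _ phi (exchangeable g')).
- rewrite EFinM -muleA; congr (_ * _); rewrite /gibbs_sum -nneseriesZl; last first.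
    by move=> n _; exact: scaled_gibbs_term_ge0.
  apply: eq_eseriesr => n _; rewrite muleCA; congr (_ * _).
  rewrite /phi; apply: ge0_integralZl => //.
  by move=> t _; rewrite mule_ge0 ?lee_fin ?expR_ge0 ?F0.
- by move=> eta; rewrite lee_fin mulr_ge0 ?expR_ge0// mulr_ge0.
- by move=> t; rewrite !mule_ge0 ?lee_fin ?expR_ge0 ?F0.
- by move=> n; apply: emeasurable_funM; [exact: measurable_cst|exact: (mi n)].
- move=> n; rewrite -[X in measurable X]setCK; apply: measurableC.
  exact: (@measurable_nonexchangeable n g').
- by move=> n; exact: ug.
- move=> t gt; have [tD tn _] := gt; split => //.
  rewrite weight_fset_set// conf_union_seq /phi -!EFinM; congr (_%:E).
  by rewrite -mulrA; congr (_ * _)%R; rewrite mulrC.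
- move=> s t st gt; have [gs e] := exchangeable_perm st gt; split => //.
  by rewrite /phi e (@eq_addl _ _ s t g' (perm_mem st)).
Qed.

Definition gibbs_partition (g : C) : \bar R :=
  \int[poisson_process D]_eta
    (expR (- (beta * energy_seq h (fset_set eta) (outside g))))%:E.

Lemma gibbs_partitionE g : (forall n, nonexchangeable_mass n (outside g) = 0) ->
  gibbs_partition g = (void_probability D)%:E * partition_sum (outside g).
Proof.
move=> ug.
have c0 (g1 : C) : (0 <= cst 1 g1 :> R)%R by exact: ler01.
rewrite -[void_probability D]mulr1.
rewrite -(gibbs_integral (measurable_cst (1 : R)%R) c0 ler01 ug).
by congr integral; apply/funext => eta; rewrite /= !mul1r.
Qed.

Lemma gibbs_partition_ge0 g :
  (forall n, nonexchangeable_mass n (outside g) = 0) ->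
  0 <= gibbs_partition g.
Proof.
move=> ug; rewrite gibbs_partitionE// mule_ge0//; first by rewrite lee_fin expR_ge0.
by rewrite (le_trans _ (partition_sum_ge1 _)).
Qed.

Lemma gibbs_partition_ae : {ae P, forall g, 0 < gibbs_partition g < +oo}.
Proof.
have := partition_sum_fin_ae; apply: filterS2 nonexchangeable_mass_ae => g ug zoo.
rewrite gibbs_partitionE//.
have z1 := partition_sum_ge1 (outside g).
have v0 : 0 < (void_probability D)%:E by rewrite lte_fin expR_gt0.
rewrite mule_gt0 ?(lt_le_trans _ z1)//= lte_mul_pinfty// ltW//.
Qed.

Lemma normalised_gibbs_integral (F : C -> R) (M : R) g : measurable_fun setT F ->
  (forall g, 0 <= F g <= M)%R ->
  (forall n, nonexchangeable_mass n (outside g) = 0) -> partition_sum (outside g) < +oo ->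
  \int[poisson_process D]_eta
    ((fine (gibbs_partition g))^-1 * F (conf_union eta (outside g)) *
     expR (- (beta * energy_seq h (fset_set eta) (outside g))))%:E =
  (gibbs_mean (EFin \o F) (outside g))%:E.
Proof.
move=> mF FM ug zoo.
have F0 g1 : (0 <= F g1)%R by have /andP[] := FM g1.
have M0 : (0 <= M)%R by have /andP[] := FM g => *; exact: (le_trans (F0 g)).
have mEF : measurable_fun setT (EFin \o F) by apply/measurable_EFinP.
have z1 := partition_sum_ge1 (outside g).
have z0 : 0 < partition_sum (outside g) by rewrite (lt_le_trans _ z1).
have zfin : partition_sum (outside g) \is a fin_num by rewrite ge0_fin_numE// ltW.
have dfin : gibbs_sum (EFin \o F) (outside g) \is a fin_num.
  rewrite ge0_fin_numE; last by apply: gibbs_sum_ge0 => g1; rewrite lee_fin.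
  apply: (@le_lt_trans _ _ (M%:E * partition_sum (outside g))); last first.
    by rewrite lte_mul_pinfty ?lee_fin.
  apply: gibbs_sum_le => // g1; rewrite lee_fin//.
  by have /andP[] := FM g1.
rewrite (gibbs_integral mF F0 _ ug); last first.
  by rewrite invr_ge0 fine_ge0// gibbs_partition_ge0.
rewrite gibbs_partitionE// -{1}(fineK dfin) -{1}(fineK zfin) -!EFinM /=.
congr (_%:E); rewrite /gibbs_mean invfM mulrA mulfV ?mul1r 1?mulrC//.
by rewrite gt_eqF// expR_gt0.
Qed.

(** The integrand is not measurable in [eta], so linearity does not apply; but the
    integral of a function is by definition the difference of those of its
    positive and negative parts, and the other factors are nonnegative. *)
Lemma signed_gibbs_integral (f : C -> R) (M : R) g : measurable_fun setT f ->
  (forall g, `|f g| <= M)%R ->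
  (forall n, nonexchangeable_mass n (outside g) = 0) -> partition_sum (outside g) < +oo ->
  \int[poisson_process D]_eta
    ((fine (gibbs_partition g))^-1 * f (conf_union eta (outside g)) *
     expR (- (beta * energy_seq h (fset_set eta) (outside g))))%:E =
  (gibbs_mean (EFin \o f^\+%R) (outside g))%:E - (gibbs_mean (EFin \o f^\-%R) (outside g))%:E.
Proof.
move=> mf fM ug zoo.
have M0 : (0 <= M)%R by exact: (le_trans _ (fM g)).
have fp g1 : (0 <= f^\+%R g1 <= M)%R.
  by rewrite /funrpos le_max lexx orbT ge_max M0 (le_trans (ler_norm _) (fM _)).
have fn g1 : (0 <= f^\-%R g1 <= M)%R.
  rewrite /funrneg le_max lexx orbT ge_max M0 andbT/=.
  by rewrite (le_trans (ler_norm _))// normrN.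
have mp : measurable_fun setT f^\+%R by exact: measurable_funrpos.
have mn : measurable_fun setT f^\-%R by exact: measurable_funrneg.
rewrite -[X in X - _](normalised_gibbs_integral mp fp ug zoo).
rewrite -[X in _ - X](normalised_gibbs_integral mn fn ug zoo).
have c0 : (0 <= (fine (gibbs_partition g))^-1)%R.
  by rewrite invr_ge0 fine_ge0// gibbs_partition_ge0.
have [Pi PiE _] := poisson_measure muE; rewrite -PiE.
rewrite [LHS]integralE; congr (_ - _); apply: eq_integral => eta _.
  rewrite funeposE/= -EFin_max /funrpos; congr (_%:E).
  by rewrite maxr_pMr// maxr_pMl ?expR_ge0// mulr0 mul0r.
rewrite funenegE/= -EFin_max /funrneg; congr (_%:E).
by rewrite maxr_pMr// maxr_pMl ?expR_ge0// mulr0 mul0r mulrN mulNr.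
Qed.

(** Off a null set of [g] the inner integral is a difference of Gibbs means, which
    are measurable, so the outer integral is linear. *)
Lemma dlr_equation (f : C -> R) (M : R) : measurable_fun setT f ->
  (forall g, `|f g| <= M)%R ->
  \int[P]_g \int[poisson_process D]_eta
    ((fine (gibbs_partition g))^-1 * f (conf_union eta (outside g)) *
     expR (- (beta * energy_seq h (fset_set eta) (outside g))))%:E =
  \int[P]_g (f g)%:E.
Proof.
move=> mf fM.
have M0 : (0 <= M)%R by exact: (le_trans _ (fM (conf_seq [::]))).
have [N [mN N0 sub]] : {ae P, forall g, (forall n, nonexchangeable_mass n (outside g) = 0) /\
    partition_sum (outside g) < +oo}.
  by have := partition_sum_fin_ae; apply: filterS2 nonexchangeable_mass_ae.
rewrite (@integral_off_null _ _ _ _ N _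
  (fun g => (gibbs_mean (EFin \o f^\+%R) (outside g))%:E
          - (gibbs_mean (EFin \o f^\-%R) (outside g))%:E) mN N0); last first.
  move=> g nN; have [ug zoo] : (forall n, nonexchangeable_mass n (outside g) = 0) /\
      partition_sum (outside g) < +oo.
    by apply: contrapT => nonexchangeable; apply: nN; exact: sub.
  exact: (signed_gibbs_integral mf fM ug zoo).
have part (F : C -> R) : measurable_fun setT F -> (forall g, 0 <= F g <= M)%R ->
    \int[P]_g (gibbs_mean (EFin \o F) (outside g))%:E = \int[P]_g (F g)%:E /\
    P.-integrable setT (EFin \o (gibbs_mean (EFin \o F) \o outside)).
  move=> mF FM; have mEF : measurable_fun setT (EFin \o F) by apply/measurable_EFinP.
  have F0 g : 0 <= (EFin \o F) g by rewrite lee_fin; have /andP[] := FM g.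
  have FM' g : (EFin \o F) g <= M%:E by rewrite lee_fin; have /andP[] := FM g.
  have e := integral_gibbs_mean mEF F0 M0 FM'; split=> //.
  apply/integrableP; split; first apply/measurable_EFinP.
    exact: (measurableT_comp (measurable_gibbs_mean mEF F0) measurable_outside).
  rewrite (eq_integral (fun g => (gibbs_mean (EFin \o F) (outside g))%:E)); last first.
    by move=> g _; rewrite /= ger0_norm// gibbs_mean_ge0.
  rewrite [ltLHS]e (@le_lt_trans _ _ (\int[P]_g (cst M%:E g)))//.
    by apply: ge0_le_integral => // g _.
  by rewrite integral_cst//= probability_setT mule1 ltry.
have fp g1 : (0 <= f^\+%R g1 <= M)%R.
  by rewrite /funrpos le_max lexx orbT ge_max M0 (le_trans (ler_norm _) (fM _)).
have fn g1 : (0 <= f^\-%R g1 <= M)%R.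
  rewrite /funrneg le_max lexx orbT ge_max M0 andbT/=.
  by rewrite (le_trans (ler_norm _))// normrN.
have [ep ip] := part _ (measurable_funrpos mf) fp.
have [en jn] := part _ (measurable_funrneg mf) fn.
rewrite [LHS](integralB_EFin measurableT ip jn) [X in X - _]ep [X in _ - X]en.
rewrite [RHS]integralE; congr (_ - _).
  by apply: eq_integral => g _; rewrite funeposE/= -EFin_max.
by apply: eq_integral => g _; rewrite funenegE/= -EFin_max.
Qed.

End gnz.

(** * From the Campbell equation to the theorem *)

Section localisation.
Context {R : realType} {d : nat}.
Local Notation E := 'rV[R]_d.
Local Notation C := (conf R d).
Variables (s beta : R) (P : probability C R) (Psi : C -> R).
Hypothesis mPsi : measurable_fun setT Psi.
Hypothesis eqP : campbell_equation s beta P Psi.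
Variables (D : set E) (mu : {sigma_finite_measure set E -> \bar R}).
Hypothesis bD : bounded_borel D.
Hypothesis muE : mu = (fun A => lebesgue_rV (A `&` D)) :> (_ -> _).
Local Open Scope ereal_scope.

(** Against a test function supported in the bounded set [D], the sum over the
    points of a configuration is finite. *)
Lemma campbell_in_region (F : (E * C)%type -> \bar R) : measurable_fun setT F ->
  (forall z, 0 <= F z) ->
  \int[P]_g \sum_(x \in points g `&` D) F (x, conf_del g x) =
  \int[mu]_x \int[P]_g (F (x, g) * (point_weight beta (h_star s Psi) x g)%:E).
Proof.
move=> mF F0; have mD := bD.1.
have [m mE] := @lebesgue_rVP R d.
have mh := measurable_h_star s mPsi.
pose W (z : (E * C)%type) := F z * (point_weight beta (h_star s Psi) z.1 z.2)%:E.
have mW : measurable_fun setT W.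
  by apply: emeasurable_funM => //; apply/measurable_EFinP; exact: measurable_point_weight.
have W0 z : 0 <= W z by rewrite mule_ge0// lee_fin expR_ge0.
have mI := @measurable_fun_fubini_tonelli_F _ _ _ _ _ P W mW W0.
have I0 x : 0 <= \int[P]_g W (x, g) by rewrite integral_ge0.
pose F' (z : (E * C)%type) := (\1_D z.1)%:E * F z.
have mF' : measurable_fun setT F'.
  apply: emeasurable_funM => //; apply/measurable_EFinP.
  exact: (measurableT_comp (measurable_indic mD) measurable_fst).
have F'0 z : 0 <= F' z by rewrite mule_ge0.
have := eqP mF' F'0; rewrite /campbell -mE => eqD.
transitivity (\int[P]_g \esum_(x in points g) F' (x, conf_del g x)).
  apply: eq_integral => g _.
  rewrite -esum_fset//; last by apply: finite_conf; exact: bD.2.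
  rewrite esum_mkcondr; apply: eq_esum => x _.
  by rewrite /F' /= indicE; case: (x \in D); rewrite ?mul1e ?mul0e.
rewrite {}eqD.
transitivity (\int[m]_(x in D) \int[P]_g W (x, g)).
  rewrite [RHS]integral_mkcond; apply: eq_integral => x _.
  rewrite patchE /F' /=; case: ifPn => xD.
    by apply: eq_integral => g _; rewrite indicE xD mul1e.
  by apply: integral0_eq => g _; rewrite indicE (negbTE xD) !mul0e.
rewrite -(ge0_integral_mrestr m mD mI I0).
apply: eq_measure_integral => A mA _.
transitivity (lebesgue_rV (A `&` D)); last exact: (esym (congr1 (@^~ A) muE)).
exact: (congr1 (@^~ (A `&` D)) mE).
Qed.

End localisation.

Theorem theorem1p14 (R : realType) (d : nat) (s beta : R)
    (hd : (1 <= d)%N) (hs : d%:R - 1 < s < d%:R) (hbeta : 0 < beta)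
    (K : R) (hK : 0 < K)
    (n_ : nat -> nat) (hn_ge1 : (1 <= n_ 0)%N)
    (hn_incr : forall j, (n_ j < n_ j.+1)%N)
    (hbound : forall j,
      (\int[gibbs_n (d := d) s beta (n_ j)]_g `| hn s (n_ j) 0%R g | <= K%:E)%E)
    (P : probability (conf R d) R)
    (phi : nat -> nat) (hphi : forall k, (phi k < phi k.+1)%N)
    (hP : cvg_local (fun k => gibbs_n s beta (n_ (phi k))) P)
    (Psi : conf R d -> R) (hPsi : measurable_fun setT Psi)
    (hcampbell : campbell_equation s beta P Psi)
    (Delta : set 'rV[R]_d) (hDelta : bounded_borel Delta)
    (f : conf R d -> R) (hf : measurable_fun setT f)
    (hfb : exists M : R, forall g, `|f g| <= M) :
  {ae P, forall g, (0 < Z_star s beta Psi Delta g < +oo)%E} /\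
  (\int[P]_g (f g)%:E =
   \int[P]_g \int[poisson_process Delta]_eta
     ((fine (Z_star s beta Psi Delta g))^-1
      * f (conf_union eta (restr g (~` Delta)))
      * expR (- (beta * H_star s Psi Delta eta g)))%:E)%E.
Proof.
have [m mE] := @lebesgue_rVP R d.
have mD : (m Delta < +oo)%E by rewrite mE; exact: lebesgue_rV_fin.
have [mu muE0] := restriction_sigma_finite hDelta.1 mD.
have muE : mu = (fun A => lebesgue_rV (A `&` Delta)) :> (_ -> _).
  by rewrite muE0 mE.
have mh := measurable_h_star s hPsi.
have gnz := campbell_in_region hPsi hcampbell hDelta muE.
have [M fM] := hfb.
(* [Z_star] is by definition [gibbs_partition], and [H_star] is [energy_seq]
   along the enumeration of [eta]. *)
split; first exact: (gibbs_partition_ae hDelta muE mh gnz).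
exact: (esym (dlr_equation hDelta muE mh gnz hf fM)).
Qed.
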